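(* Let $n \ge 3$ and let $K$ be a smooth real-valued function on $\mathbb{R}^n$. Assume that $K$ is bounded between two positive numbers outside a compact subset of $\mathbb{R}^n$. Let $u$ be a positive smooth solution of $$\Delta u + K u^{\frac{n+2}{n-2}} = 0 \quad \text{in } \mathbb{R}^n$$ with slow decay. Then either $u$ has fast decay or the conformal metric $g = u^{4/(n-2)} g_o$ on $\mathbb{R}^n$ is complete. Furthermore, the conformal metric $g$ is complete if and only if the total volume of $(\mathbb{R}^n, g)$ is infinite.
   Context: $\Delta$ is the standard Laplacian and $g_o$ the Euclidean metric on $\mathbb{R}^n$. The total volume of $(\mathbb{R}^n,g)$ is $\int_{\mathbb{R}^n} u^{\frac{2n}{n-2}}(x)\,dx$. A positive smooth solution $u$ has slow decay if there exist positive constants $C_s$, $r_s$ with $u(x) \le C_s|x|^{-(n-2)/2}$ for $|x|\ge r_s$. It has fast decay if there exist positive constants $C_f$, $r_f$ with $u(x) \le C_f |x|^{-(n-2)}$ for $|x| \ge r_f$. *)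

(* Defs.v *)
From HB Require Import structures.
From mathcomp Require Import all_boot all_order all_algebra.
From mathcomp Require Import all_classical all_reals all_analysis.
Set Implicit Arguments.
Unset Strict Implicit.
Unset Printing Implicit Defensive.
Import Order.TTheory GRing.Theory Num.Theory.
Import numFieldNormedType.Exports.

Local Open Scope classical_set_scope.
Local Open Scope ring_scope.

(* R^n is 'rV[R]_n.  The norm `|x| of the library on 'rV[R]_n is the max norm
   (with the usual topology), hence the separate Euclidean norm. *)
Section euclidean_space.
Context {R : realType} {n : nat}.
Implicit Types (f : 'rV[R]_n -> R) (x v w : 'rV[R]_n).

Definition edot v w : R := \sum_(i < n) v 0 i * w 0 i.

Definition enorm x : R := Num.sqrt (edot x x).

Definition partial (i : 'I_n) f : 'rV[R]_n -> R :=
  fun x => 'D_(delta_mx 0 i) f x.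

Definition iter_partial (s : seq 'I_n) f : 'rV[R]_n -> R :=
  foldr partial f s.

Definition smooth f : Prop :=
  forall s : seq 'I_n, continuous (iter_partial s f) /\
    forall (i : 'I_n) x, derivable (iter_partial s f) x (delta_mx 0 i).

Definition laplacian f : 'rV[R]_n -> R :=
  fun x => \sum_(i < n) partial i (partial i f) x.

End euclidean_space.

(* The n-dimensional Lebesgue measure, as the n-fold product of the
   one-dimensional one, carried by the measurable type of n-tuples (the
   library puts no sigma-algebra on 'rV[R]_n). *)
Section lebesgue_measure_tuple.
Context {R : realType}.
Local Notation RT := (measurableTypeR R).

Definition tuple_cons n (p : RT * n.-tuple RT) : n.+1.-tuple RT :=
  [the n.+1.-tuple RT of p.1 :: p.2].

Lemma measurable_tuple_cons n : measurable_fun setT (@tuple_cons n).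
Proof. exact: (measurable_cons measurable_fst measurable_snd). Qed.

Definition tuple_uncons n (t : n.+1.-tuple RT) : RT * n.-tuple RT :=
  (thead t, [tuple of behead t]).

Lemma measurable_tuple_uncons n : measurable_fun setT (@tuple_uncons n).
Proof.
apply/measurable_fun_pair => /=; last exact: measurable_behead.
exact: measurable_tnth.
Qed.

Lemma tuple_consK n : cancel (@tuple_cons n) (@tuple_uncons n).
Proof.
by case=> x t; congr pair; apply: val_inj.
Qed.

Lemma tuple_unconsK n : cancel (@tuple_uncons n) (@tuple_cons n).
Proof. by move=> t; rewrite [RHS]tuple_eta. Qed.

Section cons_measure.
Variables (n : nat)
  (mu : {sigma_finite_measure set (n.-tuple RT) -> \bar R}).

Definition cons_measure : set (n.+1.-tuple RT) -> \bar R :=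
  pushforward (lebesgue_measure \x mu)%E (@tuple_cons n).

Let cons_measure0 : cons_measure set0 = 0%E.
Proof. by rewrite /cons_measure /pushforward preimage_set0 measure0. Qed.

Let measurable_preimage_cons A :
  measurable A -> measurable (@tuple_cons n @^-1` A).
Proof.
by move=> mA; rewrite -[X in measurable X]setTI; exact: measurable_tuple_cons.
Qed.

Let cons_measure_ge0 A : (0 <= cons_measure A)%E.
Proof. by apply: integral_ge0 => x _; exact: measure_ge0. Qed.

Let cons_measure_sigma_additive : semi_sigma_additive cons_measure.
Proof.
move=> F mF tF mUF; rewrite /cons_measure /pushforward preimage_bigcup.
apply: measure_semi_sigma_additive.
- by move=> k; exact: measurable_preimage_cons.
- apply/trivIsetP => /= i j _ _ ij; rewrite -preimage_setI.
  by move/trivIsetP : tF => /(_ _ _ _ _ ij) ->//; rewrite preimage_set0.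
- by rewrite -preimage_bigcup; exact: measurable_preimage_cons.
Qed.

HB.instance Definition _ := isMeasure.Build _ _ _ cons_measure
  cons_measure0 cons_measure_ge0 cons_measure_sigma_additive.

Let cons_measure_sigma_finite : sigma_finite setT cons_measure.
Proof.
have /sigma_finiteP[F [FT ndF Foo]] := sigma_finiteT (@lebesgue_measure R).
have /sigma_finiteP[G [GT ndG Goo]] := sigma_finiteT mu.
exists (fun k => @tuple_uncons n @^-1` (F k `*` G k)).
  rewrite -preimage_bigcup -[LHS](preimage_setT (@tuple_uncons n)).
  congr (_ @^-1` _); rewrite -setXTT FT GT predeqE => -[x y]; split.
    move=> [/= [i _ Fix] [k _ Gky]]; exists (maxn i k) => //; split.
    - by move: x Fix; exact/subsetPset/ndF/leq_maxl.
    - by move: y Gky; exact/subsetPset/ndG/leq_maxr.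
  by move=> [i _ []/= ? ?]; split; exists i.
move=> k; have [mF Fk] := Foo k; have [mG Gk] := Goo k; split.
  rewrite -[X in measurable X]setTI; apply: measurable_tuple_uncons => //.
  exact: measurableX.
rewrite /cons_measure /pushforward -comp_preimage.
rewrite (_ : _ \o _ = id); last by apply/funext => p /=; rewrite tuple_consK.
by rewrite preimage_id product_measure1E// lte_mul_pinfty// ge0_fin_numE.
Qed.

HB.instance Definition _ := Measure_isSigmaFinite.Build _ _ _
  cons_measure cons_measure_sigma_finite.

End cons_measure.

Fixpoint lebesgue_measure_tuple (n : nat) :
    {sigma_finite_measure set (n.-tuple RT) -> \bar R} :=
  match n with
  | 0 => dirac ([tuple] : 0.-tuple RT)
  | m.+1 => cons_measure (lebesgue_measure_tuple m)
  end.

(* The measure of a box is the product of the measures of its sides. *)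
Lemma lebesgue_measure_tuple_box n (A : 'I_n -> set RT) :
  (forall i, measurable (A i)) ->
  lebesgue_measure_tuple n [set t | forall i, A i (tnth t i)] =
  (\prod_(i < n) lebesgue_measure (A i))%E.
Proof.
elim: n A => [|n IHn] A mA /=.
  rewrite big_ord0 diracE mem_set//; by case.
have mB : measurable
    [set t : n.-tuple RT | forall i, A (lift ord0 i) (tnth t i)].
  rewrite (_ : [set _ | _] = \bigcap_(i in [set: 'I_n])
      ((fun t : n.-tuple RT => tnth t i) @^-1` A (lift ord0 i))).
    apply: fin_bigcap_measurable => // i _.
    by rewrite -[X in measurable X]setTI; exact: measurable_tnth.
  by apply/seteqP; split => t /= Ht i; [move=> _; exact: Ht|exact: Ht].
rewrite big_ord_recl -(IHn (fun i => A (lift ord0 i)))//.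
rewrite /cons_measure /pushforward -product_measure1E//.
congr (_ _); apply/seteqP; split => -[x t] /=.
  move=> H; split; first exact: (H ord0).
  by move=> i; have := H (lift ord0 i); rewrite /tuple_cons/= tnthS.
move=> [Hx Ht] i; case: (unliftP ord0 i) => [j ->|-> //].
by rewrite /tuple_cons/= tnthS; exact: Ht.
Qed.

(* Lebesgue integral over R^n. *)
Definition integral_Rn n (f : 'rV[R]_n -> \bar R) : \bar R :=
  \int[lebesgue_measure_tuple n]_t f (\row_(i < n) tnth t i).

End lebesgue_measure_tuple.

Section riemannian_metric.
Context {R : realType} {n : nat}.

(* g x v w is the value at x of the metric on the tangent vectors v, w. *)
Definition metric_tensor : Type := 'rV[R]_n -> 'rV[R]_n -> 'rV[R]_n -> R.

Implicit Types (g : metric_tensor) (c : R -> 'rV[R]_n).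

(* C^1 on the closed interval [a, b]: the derivative on ]a, b[ extends
   continuously to [a, b]. *)
Definition C1_on (a b : R) c : Prop :=
  {within `[a, b], continuous c} /\
  exists d : R -> 'rV[R]_n, {within `[a, b], continuous d} /\
    forall t, t \in `]a, b[ -> is_derive t 1 c (d t).

Definition piecewise_C1 c : Prop :=
  exists2 s : seq R, itv_partition 0 1 s &
    forall k, (k < size s)%N -> C1_on (nth 0 (0 :: s) k) (nth 0 s k) c.

(* The finitely many break points of c, where derive1 c is arbitrary, are
   negligible for the integral. *)
Definition curve_length g c : \bar R :=
  (\int[lebesgue_measure]_(t in `[0%R, 1%R])
     (Num.sqrt (g (c t) (derive1 c t) (derive1 c t)))%:E)%E.

Definition riemannian_distance g (x y : 'rV[R]_n) : \bar R :=
  ereal_inf [set curve_length g c |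
    c in [set c | [/\ piecewise_C1 c, c 0 = x & c 1 = y]]].

Definition complete_metric g : Prop :=
  forall x : nat -> 'rV[R]_n,
    (forall e : R, 0 < e -> exists N : nat, forall j k : nat,
       (N <= j)%N -> (N <= k)%N ->
       (riemannian_distance g (x j) (x k) < e%:E)%E) ->
    exists l : 'rV[R]_n, forall e : R, 0 < e -> exists N : nat,
      forall k : nat, (N <= k)%N ->
        (riemannian_distance g (x k) l < e%:E)%E.

End riemannian_metric.
Arguments metric_tensor : clear implicits.

Section conformal_metric.
Context {R : realType} {n : nat}.
Implicit Types u : 'rV[R]_n -> R.

Definition conformal_metric u : metric_tensor R n :=
  fun x v w => u x `^ (4 / (n%:R - 2)) * edot v w.

Definition total_volume u : \bar R :=
  integral_Rn (fun x => (u x `^ (2 * n%:R / (n%:R - 2)))%:E).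

Definition slow_decay u : Prop :=
  exists Cs rs : R, [/\ 0 < Cs, 0 < rs &
    forall x, rs <= enorm x -> u x <= Cs * enorm x `^ (- ((n%:R - 2) / 2))].

Definition fast_decay u : Prop :=
  exists Cf rf : R, [/\ 0 < Cf, 0 < rf &
    forall x, rf <= enorm x -> u x <= Cf * enorm x `^ (- (n%:R - 2))].

End conformal_metric.

(* Main.v *)
(** Write N = n - 2.  Outside a ball u solves [Laplacian u + V u = 0] with
    [V = K u^(4/N)], and slow decay gives [V = O(|x|^-2)]; everything needed
    about u follows from the maximum principle with explicit barriers.

    If [u <= e |x|^(-N/2)] near infinity with e small, then V lies below the
    Hardy-type threshold of the powers [|x|^(-3N/4)] and [|x|^(-N/4)], so that u
    decays like the former; V is then [O(|x|^-3)] and the barrier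
    [|x|^-N - |x|^(-N-1/2)] yields fast decay.

    Otherwise [u > e |x|^(-N/2)] at points y with [|y| = r] arbitrarily large.  An
    interior Lipschitz bound spreads this to a ball of radius comparable to r
    about y, and comparison with [|x - y|^-N - 3^-N |x|^-N] in the exterior
    domain spreads it to the annulus [r <= |x| <= 2 r].  There
    [u^(2/N) >= m / r], so every such annulus contributes a fixed amount both to
    the length of a curve crossing it and to the volume: the metric is complete
    and its volume is infinite.  Under fast decay [u^(2/N) = O(|x|^-2)], rays
    have finite length and the volume is finite. *)
Require Import Defs.
From HB Require Import structures.
From mathcomp Require Import all_boot all_order all_algebra.
From mathcomp Require Import all_classical all_reals all_analysis.
From mathcomp Require Import measurable_realfun ring lra.
Set Implicit Arguments.
Unset Strict Implicit.
Unset Printing Implicit Defensive.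
Import Order.TTheory GRing.Theory Num.Theory.
Import numFieldNormedType.Exports.

Local Open Scope classical_set_scope.
Local Open Scope ring_scope.

(** * Second derivatives, the pointwise Laplacian and the comparison principle *)

(** N/2 is the scaling exponent of the equation. With slow decay V is at most of order |x|^-2, so on
    a ball of radius proportional to r about a point at distance r all estimates have constants
    independent of r. A lower bound of order 1/r for u^(2/N) then integrates to a fixed amount
    across every annulus. Since the Laplacian of |x|^-p is - p (N - p) |x|^(-p-2), the exponents N/4
    and 3N/4 share the coefficient 3 N^2 / 16. The slower power controls u at infinity, where no
    boundary value is available, and the faster one is the decay that results. No Harnack inequality
    for a general potential is needed. Outside a ball K > 0 makes u superharmonic, and slow decay
    bounds its Laplacian from below; the first fact spreads lower bounds, the second gives the
    Lipschitz estimate. Lengths are bounded below through functions whose gradient is at most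
    u^(2/N), so that the times at which a curve enters or leaves an annulus never matter. Each
    alternative settles completeness and volume together, which yields the equivalence. *)

Section second_derivative.
Context {R : realType}.
Implicit Types (f g : R -> R) (d e : R).

(** A relation with a witness [f1], so that differentiability travels with the value. The point is
    always 0 because f will be the restriction of a function to a coordinate line through the point
    of interest. *)
Definition d2at f d := exists f1 : R -> R,
  (\forall t \near (0 : R), is_derive t (1 : R) f (f1 t)) /\ is_derive (0 : R) (1 : R) f1 d.

(** If d were positive, [f1], which vanishes at the interior maximum, would be positive just to the
    right of 0, and the mean value theorem would give values above f 0. *)
Lemma d2at_max f d :
  d2at f d -> (\forall t \near (0 : R), f t <= f 0) -> d <= 0.
Proof.
move=> [f1 [df df1]] fmax; rewrite leNgt; apply/negP => d0.
have [e /= e0 He] : exists2 e, 0 < e & forall t, `|t| < e ->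
    is_derive t (1 : R) f (f1 t) /\ f t <= f 0.
  have /nbhs_ballP[e /= e0 He] : nbhs (0 : R)
      [set t | is_derive t (1 : R) f (f1 t) /\ f t <= f 0].
    exact: filterI df fmax.
  by exists e => // t te; apply: He; rewrite /ball /= sub0r normrN.
have f10 : f1 0 = 0.
  have d0f : is_derive (0 : R) (1 : R) f 0.
    apply: (@derive1_at_max _ _ (- e) e); rewrite ?in_itv/= ?oppr_lt0 ?e0//.
    - lra.
    - by move=> t; rewrite in_itv/= -ltr_norml => /He[].
    - by move=> t; rewrite in_itv/= -ltr_norml => /He[].
  have [|df0 _] := He 0; first by rewrite normr0.
  by rewrite -(@derive_val _ _ _ _ _ _ _ df0) (@derive_val _ _ _ _ _ _ _ d0f).
have [e' /= e'0 He'] : exists2 e', 0 < e' & forall t, 0 < t < e' -> 0 < f1 t.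
  have [df1' df1v] := df1.
  have : (h^-1 *: (f1 (h *: 1 + 0) - f1 0)) @[h --> 0^'] --> d.
    by rewrite -df1v; exact: df1'.
  move=> /cvgrPdist_lt /(_ _ d0)[/= r r0 Hr].
  exists r => // t /andP[t0 tr].
  have := Hr t; rewrite /ball_ /= sub0r normrN gtr0_norm// => /(_ tr).
  rewrite gt_eqF// => /(_ isT); rewrite f10 subr0 addr0 /GRing.scale/= mulr1.
  rewrite ltr_norml ltrBlDr ltrDl => /andP[_].
  by rewrite pmulr_rgt0// invr_gt0.
pose s := Num.min e e' / 2.
have s0 : 0 < s by rewrite divr_gt0// lt_min e0 e'0.
have se : s < Num.min e e' by rewrite /s ltr_pdivrMr// ltr_pMr ?lt_min ?e0 ?e'0// ltr1n.
move: se; rewrite lt_min => /andP[se se'].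
have [c|c|c] := @MVT _ f f1 0 s s0.
- rewrite in_itv/= => /andP[c0 cs]; apply: (He c _).1.
  by rewrite gtr0_norm// (lt_trans cs).
- apply: derivable_within_continuous => t; rewrite in_itv/= => /andP[t0 ts].
  by have [|[]] := He t; rewrite ?ger0_norm// (le_lt_trans ts).
rewrite in_itv/= => /andP[c0 cs] /eqP; rewrite subr0; apply/negP.
rewrite lt_eqF// (@le_lt_trans _ _ 0)//.
  by rewrite subr_le0; apply: (He s _).2; rewrite gtr0_norm.
by rewrite mulr_gt0// He'// c0 (lt_trans cs).
Qed.

Lemma d2atD f g d e : d2at f d -> d2at g e -> d2at (fun t => f t + g t) (d + e).
Proof.
move=> [f1 [df df1]] [g1 [dg dg1]]; exists (f1 + g1); split; last first.
  exact: is_deriveD.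
by near=> t; apply: is_deriveD; near: t.
Unshelve. all: by end_near. Qed.

Lemma d2atZ (k : R) f d : d2at f d -> d2at (fun t => k * f t) (k * d).
Proof.
move=> [f1 [df df1]]; exists (k \*: f1); split; last exact: is_deriveZ.
by near=> t; apply: is_deriveZ; near: t.
Unshelve. all: by end_near. Qed.

Lemma d2at_cst (k : R) : d2at (fun=> k) 0.
Proof.
exists (cst 0); split; last exact: is_derive_cst.
by near=> t; exact: is_derive_cst.
Unshelve. all: by end_near. Qed.

Lemma d2atN f d : d2at f d -> d2at (fun t => f (- t)) d.
Proof.
move=> [f1 [df df1]]; exists (fun t => - f1 (- t)); split.
  have : \forall t \near (0 : R), is_derive (- t) (1 : R) f (f1 (- t)).
    have cN : -%R @ (0 : R) --> (0 : R).
      by have := @opp_continuous R 0; rewrite /continuous_at oppr0.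
    exact: cN _ df.
  apply: filterS => t dft; rewrite -mulrN1.
  exact: (@is_derive1_comp _ f (fun t => - t) t).
rewrite -[d]opprK; apply: is_deriveN; rewrite -mulrN1.
by apply: (@is_derive1_comp _ f1 (fun t => - t)); rewrite oppr0.
Unshelve. all: by end_near. Qed.

Lemma is_derive_quad (a b c t : R) :
  is_derive t (1 : R) (fun s => a * s ^+ 2 + b * s + c) (2 * a * t + b).
Proof.
apply/is_derive1_caratheodory; exists (fun s => a * (s + t) + b); split.
- by move=> s; ring.
- have cid : {for t, continuous (@id R)} by exact: cvg_id.
  have c1 := continuousD cid (@cst_continuous _ _ t t).
  have c2 := continuousM (@cst_continuous _ _ a t) c1.
  exact: (continuousD c2 (@cst_continuous _ _ b t)).
- by ring.
Qed.

Lemma is_derive_affine (b c t : R) : is_derive t (1 : R) (fun s => b * s + c) b.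
Proof.
have := is_derive_quad 0 b c t; rewrite mulr0 mul0r add0r.
by under eq_fun do rewrite mul0r add0r.
Qed.

Lemma d2at_quad (a b c : R) : d2at (fun t => a * t ^+ 2 + b * t + c) (2 * a).
Proof.
exists (fun t => 2 * a * t + b); split; last exact: is_derive_affine.
by near=> t; exact: is_derive_quad.
Unshelve. all: by end_near. Qed.

(** The quadratic polynomial is the squared distance to a point z along a coordinate line: s is its
    value at t = 0 and b the corresponding coordinate of x - z. *)
Lemma d2at_powR (q b s : R) : 0 < s ->
  d2at (fun t => (s + 2 * b * t + t ^+ 2) `^ q)
    (q * (q - 1) * s `^ (q - 2) * (4 * b ^+ 2) + 2 * q * s `^ (q - 1)).
Proof.
move=> s0; pose p t : R := 1 * t ^+ 2 + 2 * b * t + s.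
have -> : (fun t => (s + 2 * b * t + t ^+ 2) `^ q) = (fun x => x `^ q) \o p.
  by apply/funext => t /=; congr powR; rewrite /p; ring.
have dp (t : R) : is_derive t (1 : R) p (2 * 1 * t + 2 * b).
  exact: is_derive_quad.
have p0 : p 0 = s by rewrite /p mulr0 expr0n /= mulr0 !add0r.
have cp : {for 0, continuous p}.
  by apply: differentiable_continuous; apply/derivable1_diffP; exact: ex_derive.
have dpow (r t : R) : 0 < p t -> is_derive t (1 : R) ((fun x => x `^ r) \o p)
    (r * p t `^ (r - 1) * (2 * 1 * t + 2 * b)).
  by move=> pt; have dr := is_derive1_powR r pt; exact: is_derive1_comp.
exists (fun t => q * p t `^ (q - 1) * (2 * 1 * t + 2 * b)); split.
  have : \forall t \near (0:R), 0 < p t.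
    have /cp : nbhs (p 0) [set x | 0 < x] by rewrite p0; exact: lt_nbhsr.
    by [].
  by apply: filterS => t; exact: dpow.
have d1 : is_derive (0 : R) (1 : R) ((fun x => x `^ (q - 1)) \o p)
    ((q - 1) * s `^ (q - 2) * (2 * b)).
  have := @dpow (q - 1) 0; rewrite p0 mulr0 add0r (_ : q - 1 - 1 = q - 2).
    exact.
  by ring.
have d2 := is_deriveZ q d1.
have d3 := is_deriveM d2 (is_derive_affine (2 * 1) (2 * b) 0).
apply: trigger_derive d3 _.
have -> : (q \*: ((fun x => x `^ (q - 1)) \o p)) 0 = q * s `^ (q - 1).
  by rewrite /= p0.
by rewrite /GRing.scale /=; ring.
Qed.

End second_derivative.

Section euclidean_norm.
Context {R : realType} {n : nat}.
Implicit Types (x y z v w : 'rV[R]_n).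

Lemma edotC v w : edot v w = edot w v.
Proof. by apply: eq_bigr => i _; rewrite mulrC. Qed.

Lemma edotDl v w z : edot (v + w) z = edot v z + edot w z.
Proof. by rewrite -big_split; apply: eq_bigr => i _; rewrite mxE mulrDl. Qed.

Lemma edotZl (a : R) v w : edot (a *: v) w = a * edot v w.
Proof. by rewrite mulr_sumr; apply: eq_bigr => i _; rewrite mxE mulrA. Qed.

Lemma edotDr v w z : edot z (v + w) = edot z v + edot z w.
Proof. by rewrite edotC edotDl !(edotC z). Qed.

Lemma edotZr (a : R) v w : edot v (a *: w) = a * edot v w.
Proof. by rewrite edotC edotZl edotC. Qed.

Lemma edotNN v : edot (- v) (- v) = edot v v.
Proof. by rewrite -scaleN1r edotZl edotZr mulrA mulrNN !mul1r. Qed.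

Lemma edot_delta v i : edot v (delta_mx 0 i) = v 0 i.
Proof.
rewrite /edot (bigD1 i)//= big1 ?mxE ?eqxx ?mulr1 ?addr0// => j ji.
by rewrite mxE (negPf ji) andbF mulr0.
Qed.

Lemma edot_ge0 v : 0 <= edot v v.
Proof. by apply: sumr_ge0 => i _; rewrite -expr2 sqr_ge0. Qed.

Lemma enorm_ge0 v : 0 <= enorm v.
Proof. exact: sqrtr_ge0. Qed.

Lemma enorm_sqr v : enorm v ^+ 2 = edot v v.
Proof. by rewrite sqr_sqrtr// edot_ge0. Qed.

Lemma enormN v : enorm (- v) = enorm v.
Proof. by rewrite /enorm edotNN. Qed.

Lemma enormB v w : enorm (v - w) = enorm (w - v).
Proof. by rewrite -enormN opprB. Qed.

Lemma enormZ (a : R) v : enorm (a *: v) = `|a| * enorm v.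
Proof.
by rewrite /enorm edotZl edotZr mulrA -expr2 sqrtrM ?sqr_ge0// sqrtr_sqr.
Qed.

Lemma enorm_delta i : enorm (delta_mx 0 i : 'rV[R]_n) = 1.
Proof. by rewrite /enorm edot_delta mxE !eqxx sqrtr1. Qed.

Lemma coord_le_enorm v i : `|v 0 i| <= enorm v.
Proof.
rewrite -sqrtr_sqr ler_wsqrtr// /edot (bigD1 i)//= -expr2 lerDl.
by apply: sumr_ge0 => j _; rewrite -expr2 sqr_ge0.
Qed.

Lemma enorm_eq0 v : enorm v = 0 -> v = 0.
Proof.
move=> v0; apply/rowP => i; rewrite mxE; apply/eqP; rewrite -normr_le0.
by rewrite (le_trans (coord_le_enorm _ _))// v0.
Qed.

(** Cauchy-Schwarz, by expanding the square of |w| v - |v| w. *)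
Lemma edot_le v w : edot v w <= enorm v * enorm w.
Proof.
have [|wn0] := eqVneq (enorm v * enorm w) 0.
  have e0 z : edot 0 z = 0 by rewrite -(scale0r 0) edotZl mul0r.
  move=> /eqP; rewrite mulf_eq0 => /orP[]/eqP/[dup] vw0 /enorm_eq0 ->.
    by rewrite e0 mulr_ge0// enorm_ge0.
  by rewrite edotC e0 mulr_ge0// enorm_ge0.
have vw0 : 0 < enorm v * enorm w by rewrite lt0r wn0 mulr_ge0// enorm_ge0.
have := edot_ge0 (enorm w *: v + (- enorm v) *: w).
rewrite !(edotDl, edotDr, edotZl, edotZr) -!enorm_sqr (edotC w v) => H.
rewrite -(ler_pM2l vw0); nra.
Qed.

Lemma enormD v w : enorm (v + w) <= enorm v + enorm w.
Proof.
rewrite -[leRHS]ger0_norm ?addr_ge0 ?enorm_ge0// -sqrtr_sqr ler_wsqrtr//.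
rewrite !(edotDl, edotDr) -!enorm_sqr (edotC w v).
by have := edot_le v w; nra.
Qed.

Lemma enorm_le_coord v (d : R) :
  0 <= d -> (forall i, `|v 0 i| <= d) -> enorm v <= n%:R * d.
Proof.
move=> d0 vd.
rewrite -[leRHS]ger0_norm ?mulr_ge0// -sqrtr_sqr ler_wsqrtr//.
apply: (@le_trans _ _ (\sum_(i < n) d ^+ 2)).
  apply: ler_sum => i _; rewrite -expr2 -real_normK ?num_real//.
  by rewrite lerXn2r// nnegrE.
rewrite sumr_const card_ord exprMn -[leLHS]mulr_natl ler_wpM2r ?sqr_ge0//.
by rewrite -natrX ler_nat; case: (n) => // k; rewrite leq_pmulr.
Qed.

Lemma mx_norm_le_enorm v : `|v| <= enorm v.
Proof.
rewrite [leLHS]/Num.Def.normr/= mx_normrE (bigmax_le _ (enorm_ge0 v))//= => -[i j] _.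
by rewrite (ord1 i) coord_le_enorm.
Qed.

Lemma continuous_edot z : continuous (fun x => edot (x - z) (x - z)).
Proof.
move=> x; have -> : (fun x => edot (x - z) (x - z)) =
    (\sum_(i < n) fun x => (x 0 i - z 0 i) * (x 0 i - z 0 i)).
  by apply/funext => y; rewrite fct_sumE; apply: eq_bigr => i _; rewrite !mxE.
apply: (big_ind (fun f : 'rV[R]_n -> R => {for x, continuous f})).
- exact: cst_continuous.
- by move=> f g cf cg; exact: (continuousD cf cg).
- move=> i _.
  have c : {for x, continuous (fun y : 'rV[R]_n => y 0 i - z 0 i)}.
    apply: continuousB; last exact: cst_continuous.
    exact: coord_continuous.
  exact: (continuousM c c).
Qed.

Lemma continuous_enorm z : continuous (fun x => enorm (x - z)).
Proof.
move=> x; exact: (continuous_comp (@continuous_edot z x) (@sqrt_continuous R _)).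
Qed.

Lemma closed_fun_le (f : 'rV[R]_n -> R) a :
  continuous f -> closed [set x | f x <= a].
Proof. by move=> cf; apply: (closed_comp _ (@closed_le _ a)) => x _; exact: cf. Qed.

Lemma closed_fun_ge (f : 'rV[R]_n -> R) a :
  continuous f -> closed [set x | a <= f x].
Proof. by move=> cf; apply: (closed_comp _ (@closed_ge _ a)) => x _; exact: cf. Qed.

Lemma nbhs_fun_le (f : 'rV[R]_n -> R) a x :
  continuous f -> f x < a -> nbhs x [set x | f x <= a].
Proof.
move=> cf fxa; have /cf fx : nbhs (f x) [set y | y < a] by exact: lt_nbhsl.
by apply: (@filterS _ (nbhs x) _ (f @^-1` [set y | y < a])) => // y /ltW.
Qed.

Lemma nbhs_fun_ge (f : 'rV[R]_n -> R) a x :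
  continuous f -> a < f x -> nbhs x [set x | a <= f x].
Proof.
move=> cf fxa; have /cf fx : nbhs (f x) [set y | a < y] by exact: lt_nbhsr.
by apply: (@filterS _ (nbhs x) _ (f @^-1` [set y | a < y])) => // y /ltW.
Qed.

Lemma enorm_bounded_closed_compact (D : set 'rV[R]_n) z (T : R) :
  closed D -> (forall x, D x -> enorm (x - z) <= T) -> compact D.
Proof.
move=> cD DT; apply: bounded_closed_compact cD.
exists (T + `|z|); split; first exact: num_real.
move=> M TM x Dx /=; rewrite (le_trans _ (ltW TM))// -[x](subrK z).
by rewrite (le_trans (ler_normD _ _))// lerD2r (le_trans (mx_norm_le_enorm _))// DT.
Qed.

Lemma compact_enorm_bounded (C : set 'rV[R]_n) :
  compact C -> exists2 T, 0 < T & forall x, C x -> enorm x <= T.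
Proof.
move=> cC; have [->|/set0P C0] := eqVneq C set0; first by exists 1.
have [|c _ cmax] := EVT_max_rV C0 cC (f := fun x => enorm (x - 0)).
  by apply: continuous_subspaceT => x; exact: continuous_enorm.
exists (1 + enorm c); first by rewrite ltr_wpDr// enorm_ge0.
move=> x /mem_set /cmax; rewrite !subr0 => /le_trans; apply.
by rewrite lerDr.
Qed.

End euclidean_norm.

Section pointwise_laplacian.
Context {R : realType} {n : nat}.
Implicit Types (F G : 'rV[R]_n -> R) (x y z : 'rV[R]_n).

Local Notation "''e_' i" := (delta_mx 0 i : 'rV[R]_n) (at level 8, i at level 2).

(** Pointwise, because the barriers are singular at a point and hence not [smooth]. Second
    derivatives along the coordinate lines through x are all that the maximum principle uses. *)
Definition has_lap F x (L : R) := exists2 d : 'I_n -> R,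
  forall i, d2at (fun t => F (x + t *: 'e_i)) (d i) & L = \sum_(i < n) d i.

Lemma continuous_line x v : continuous (fun t : R => x + t *: v).
Proof.
move=> t; apply: (@continuousD R 'rV[R]_n R (cst x) (fun t => t *: v)).
  exact: cst_continuous.
exact: scalel_continuous.
Qed.

Lemma has_lap_max F x L (D : set 'rV[R]_n) :
  has_lap F x L -> nbhs x D -> (forall y, D y -> F y <= F x) -> L <= 0.
Proof.
move=> [d Fd ->] xD Fmax; apply: sumr_le0 => i _; apply: d2at_max (Fd i) _.
rewrite scale0r addr0.
have /continuous_line : nbhs (x + (0 : R) *: 'e_i) D by rewrite scale0r addr0.
move=> H; apply: (@filterS _ (nbhs (0 : R)) _ _ _ _ H) => t /=; exact: Fmax.
Qed.

Lemma has_lapD F G x L M :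
  has_lap F x L -> has_lap G x M -> has_lap (fun y => F y + G y) x (L + M).
Proof.
move=> [d Fd ->] [e Ge ->]; exists (fun i => d i + e i); last by rewrite big_split.
by move=> i; exact: d2atD.
Qed.

Lemma has_lapZ (k : R) F x L : has_lap F x L -> has_lap (fun y => k * F y) x (k * L).
Proof.
move=> [d Fd ->]; exists (fun i => k * d i); last by rewrite mulr_sumr.
by move=> i; exact: d2atZ.
Qed.

Lemma has_lap_cst (k : R) x : has_lap (fun=> k) x 0.
Proof. by exists (fun=> 0); [move=> i; exact: d2at_cst|rewrite big1]. Qed.

Lemma has_lapB F G x L M :
  has_lap F x L -> has_lap G x M -> has_lap (fun y => F y - G y) x (L - M).
Proof.
move=> FL /(has_lapZ (-1)) GM; have := has_lapD FL GM; rewrite mulN1r.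
by under eq_fun do rewrite mulN1r.
Qed.

Lemma has_lap_sum (I : Type) (r : seq I) (P : pred I) (F : I -> 'rV[R]_n -> R) x L :
  (forall i, has_lap (F i) x (L i)) ->
  has_lap (fun y => \sum_(i <- r | P i) F i y) x (\sum_(i <- r | P i) L i).
Proof.
move=> FL; have -> : (fun y => \sum_(i <- r | P i) F i y) = \sum_(i <- r | P i) F i.
  by apply/funext => y; rewrite fct_sumE.
apply: (big_ind2 (fun G M => has_lap G x M)) => //; first exact: has_lap_cst.
by move=> ? ? ? ? h1 h2; exact: (has_lapD h1 h2).
Qed.

Lemma has_lap_smooth F x : smooth F -> has_lap F x (laplacian F x).
Proof.
move=> sF; exists (fun i => partial i (partial i F) x) => // i.
have lineE (G : 'rV[R]_n -> R) (y : R) : (forall w, derivable G w 'e_i) ->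
    is_derive (y : R) (1 : R) (fun t => G (x + t *: 'e_i))
      (partial i G (x + y *: 'e_i)).
  move=> dG.
  (* The difference quotient of G along the line and that of G in the direction e_i are the same
     function of h, so no chain rule is involved. *)
  have E : (fun h : R => h^-1 *: (((fun t : R => G (x + t *: 'e_i)) \o shift y)
        (h *: (1 : R)) - G (x + y *: 'e_i))) =
      (fun h : R => h^-1 *: ((G \o shift (x + y *: 'e_i)) (h *: 'e_i)
        - G (x + y *: 'e_i))).
    apply/funext => h /=; congr (_ *: (G _ - _)).
    by rewrite scalerDl [h *: 1]mulr1 addrCA addrC.
  split; first by have := dG (x + y *: 'e_i); rewrite /derivable -E.
  by rewrite /partial /derive -E.
exists (fun t => partial i F (x + t *: 'e_i)); split.
  by near=> t; apply: lineE => y; exact: (sF [::]).2.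
rewrite -[in X in is_derive _ _ _ X](addr0 x) -(scale0r 'e_i).
by apply: lineE => y; exact: (sF [:: i]).2.
Unshelve. all: by end_near. Qed.

(** The radial formula with coefficient p (p + n - 2), where p = 2q. Powers of the squared distance
    restrict to powers of a quadratic polynomial on each line. *)
Lemma has_lap_powR z (q : R) x : 0 < edot (x - z) (x - z) ->
  has_lap (fun y => edot (y - z) (y - z) `^ q) x
    (2 * q * (2 * q + (n%:R - 2)) * edot (x - z) (x - z) `^ (q - 1)).
Proof.
set s := edot (x - z) (x - z) => s0.
exists (fun i => q * (q - 1) * s `^ (q - 2) * (4 * (x - z) 0 i ^+ 2)
    + 2 * q * s `^ (q - 1)).
  move=> i; have := d2at_powR q ((x - z) 0 i) s0.
  congr d2at; apply/funext => t; congr (_ `^ _).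
  have -> : x + t *: 'e_i - z = (x - z) + t *: 'e_i by rewrite addrAC.
  rewrite {}/s in s0 *; move: (x - z) => w.
  rewrite edotDl !edotDr !(edotZl, edotZr) (edotC 'e_i w) !edot_delta.
  by rewrite (_ : 'e_i 0 i = 1); [ring|rewrite mxE !eqxx].
rewrite big_split/= sumr_const card_ord -mulr_sumr -mulr_sumr.
have -> : \sum_(i < n) (x - z) 0 i ^+ 2 = s.
  by apply: eq_bigr => i _; rewrite expr2.
have -> : s `^ (q - 1) = s `^ (q - 2) * s.
  rewrite -{3}[s]powRr1 ?ltW// -powRD; last by rewrite (gt_eqF s0) implybT.
  by congr powR; ring.
by rewrite -mulr_natl; ring.
Qed.

Lemma has_lap_coord (a b c : R) z j x :
  has_lap (fun y => a * (y 0 j - z 0 j) ^+ 2 + b * (y 0 j - z 0 j) + c) x (2 * a).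
Proof.
exists (fun i => 2 * a * (i == j)%:R); last first.
  rewrite (bigD1 j)//= eqxx mulr1 big1 ?addr0// => i /negPf ->; exact: mulr0.
move=> i; case: eqVneq => [->|ij] /=; last first.
  rewrite mulr0; have := @d2at_cst R (a * (x 0 j - z 0 j) ^+ 2 + b * (x 0 j - z 0 j) + c).
  congr d2at; apply/funext => t; rewrite !mxE (eq_sym j) (negPf ij) andbF.
  by rewrite mulr0 addr0.
have := d2at_quad a (2 * a * (x 0 j - z 0 j) + b)
  (a * (x 0 j - z 0 j) ^+ 2 + b * (x 0 j - z 0 j) + c).
rewrite mulr1; congr d2at; apply/funext => t; rewrite !mxE !eqxx /=; ring.
Qed.

Definition reflect_coord z (i : 'I_n) x : 'rV[R]_n :=
  x - (2 * (x 0 i - z 0 i)) *: 'e_i.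

(** In the direction i the reflection only replaces t by -t, which a second derivative does not
    see. *)
Lemma has_lap_reflect F z i x L : has_lap F (reflect_coord z i x) L ->
  has_lap (F \o reflect_coord z i) x L.
Proof.
move=> [d Fd ->]; exists d => // j.
have [->|ij] := eqVneq j i.
  have := d2atN (Fd i); congr d2at; apply/funext => t /=; congr F.
  apply/rowP => k; rewrite /reflect_coord !mxE !eqxx /=; ring.
have := Fd j; congr d2at; apply/funext => t /=; congr F.
apply/rowP => k; rewrite /reflect_coord !mxE !eqxx (eq_sym i) (negPf ij) /=; ring.
Qed.

(* At a maximum point of [u / phi] with value s > 1 the function [u - s phi]
   has a zero maximum, so its Laplacian cannot be positive there. *)
Lemma comparison (D : set 'rV[R]_n) (u phi : 'rV[R]_n -> R) :
  compact D -> {within D, continuous u} -> {within D, continuous phi} ->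
  (forall x, D x -> 0 < phi x) ->
  (forall x, D x -> u x <= phi x \/ (nbhs x D /\ exists Lu Lphi,
     [/\ has_lap u x Lu, has_lap phi x Lphi &
         forall s, 1 < s -> u x = s * phi x -> s * Lphi < Lu])) ->
  forall x, D x -> u x <= phi x.
Proof.
move=> cD cu cphi phi0 H x0 Dx0; rewrite leNgt; apply/negP => ux0.
have D0 : D !=set0 by exists x0.
have [|c cinD cmax] := EVT_max_rV D0 cD (f := fun x => u x / phi x).
  apply/subspace_continuousP => x Dx; apply: cvgM.
    exact: (subspace_continuousP D u).1.
  by apply: cvgV; [rewrite gt_eqF// phi0|exact: (subspace_continuousP D phi).1].
have Dc : D c by rewrite inE in cinD.
have pc := phi0 _ Dc.
pose s := u c / phi c.
have s1 : 1 < s.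
  apply: lt_le_trans (cmax _ (mem_set Dx0)).
  by rewrite ltr_pdivlMr ?phi0// mul1r.
have ucE : u c = s * phi c by rewrite /s divfK// gt_eqF.
have [|[ncD [Lu [Lphi [hu hphi]]]]] := H _ Dc.
  by rewrite ucE; apply/negP; rewrite -ltNge ltr_pMl.
move=> /(_ _ s1 ucE); apply/negP; rewrite -leNgt -subr_le0.
apply: (has_lap_max (has_lapB hu (has_lapZ s hphi)) ncD) => y Dy.
rewrite ucE subrr subr_le0 -ler_pdivrMr ?phi0//.
exact: cmax (mem_set Dy).
Qed.

End pointwise_laplacian.

(** * Decay at infinity by comparison *)

Section powR_complements.
Context {R : realType}.
Implicit Types r s p q : R.

Lemma powRDp r p q : 0 < r -> r `^ (p + q) = r `^ p * r `^ q.
Proof. by move=> r0; rewrite powRD// (gt_eqF r0) implybT. Qed.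

Lemma le0_ler_powR p r s : p <= 0 -> 0 < r -> r <= s -> s `^ p <= r `^ p.
Proof.
move=> p0 r0 rs; have s0 := lt_le_trans r0 rs.
rewrite -[p]opprK (powRN s) (powRN r) lef_pV2 ?posrE ?powR_gt0//.
by rewrite ge0_ler_powR ?oppr_ge0// nnegrE ltW.
Qed.

Lemma powRKl p r : 0 < r -> p != 0 -> (r `^ p^-1) `^ p = r.
Proof. by move=> r0 p0; rewrite -powRrM mulVf// powRr1// ltW. Qed.

Lemma continuous_powR p r : 0 < r -> {for r, continuous (fun t => t `^ p)}.
Proof.
move=> r0; apply: differentiable_continuous; apply/derivable1_diffP.
by apply: ex_derive; exact: is_derive1_powR.
Qed.

End powR_complements.

Section enorm_power.
Context {R : realType} {n : nat}.
Implicit Types (x y z : 'rV[R]_n) (q : R).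

Lemma has_lap_enorm z q x : 0 < enorm (x - z) ->
  has_lap (fun y => enorm (y - z) `^ q) x
    (q * (q + (n%:R - 2)) * enorm (x - z) `^ (q - 2)).
Proof.
move=> xz; have E y p : enorm (y - z) `^ p = edot (y - z) (y - z) `^ (p / 2).
  by rewrite /enorm -powR12_sqrt ?edot_ge0// -powRrM mulrC.
have s0 : 0 < edot (x - z) (x - z) by rewrite -enorm_sqr exprn_gt0.
have -> : (fun y => enorm (y - z) `^ q) =
    (fun y => edot (y - z) (y - z) `^ (q / 2)) by apply/funext => y; exact: E.
rewrite E (_ : (q - 2) / 2 = q / 2 - 1); last by field.
have := has_lap_powR (q / 2) s0.
by rewrite (_ : 2 * (q / 2) = q); last by rewrite mulrC divfK.
Qed.

Lemma has_lap_enorm0 q x : 0 < enorm x ->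
  has_lap (fun y => enorm y `^ q) x (q * (q + (n%:R - 2)) * enorm x `^ (q - 2)).
Proof.
move=> x0; have -> : (fun y => enorm y `^ q) = (fun y => enorm (y - 0) `^ q).
  by apply/funext => y; rewrite subr0.
by have := @has_lap_enorm 0 q x; rewrite !subr0; apply.
Qed.

Lemma continuous_enorm_powR z q x : 0 < enorm (x - z) ->
  {for x, continuous (fun y => enorm (y - z) `^ q)}.
Proof.
move=> xz.
exact: (continuous_comp (@continuous_enorm R n z x) (@continuous_powR _ q _ xz)).
Qed.

Lemma continuous_enorm_powR0 q x : 0 < enorm x ->
  {for x, continuous (fun y => enorm y `^ q)}.
Proof.
move=> x0; have -> : (fun y => enorm y `^ q) = (fun y => enorm (y - 0) `^ q).
  by apply/funext => y; rewrite subr0.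
by apply: continuous_enorm_powR; rewrite subr0.
Qed.

Lemma continuous_enorm0 : continuous (@enorm R n).
Proof.
have -> : @enorm R n = (fun y => enorm (y - 0)) by apply/funext => y; rewrite subr0.
exact: continuous_enorm.
Qed.

End enorm_power.

Section exterior_decay.
Context {R : realType} {n : nat}.

Definition potential (K u : 'rV[R]_n -> R) (N : R) (x : 'rV[R]_n) : R :=
  K x * u x `^ (4 / N).

(** N is a real parameter tied to n by [sol_dim], so that identities between exponents become field
    identities in N; (N + 4) / N is the critical exponent (n + 2) / (n - 2). *)
Record exterior_solution (K u : 'rV[R]_n -> R) (N R0 a b : R) : Prop := {
  sol_dim : n%:R = N + 2;
  sol_N_ge1 : 1 <= N;
  sol_gt0 : forall x, 0 < u x;
  sol_smooth : smooth u;
  sol_eq : forall x, laplacian u x + K x * u x `^ ((N + 4) / N) = 0;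
  sol_R0_gt0 : 0 < R0;
  sol_a_gt0 : 0 < a;
  sol_b_gt0 : 0 < b;
  sol_K_bounds : forall x, R0 <= enorm x -> a <= K x <= b
}.

Context {K u : 'rV[R]_n -> R} {N R0 a b : R}.
Context (sol : exterior_solution K u N R0 a b).

Let n2 : n%:R - 2 = N. Proof. by rewrite (sol_dim sol) addrK. Qed.

Lemma sol_N_gt0 : 0 < N. Proof. exact: lt_le_trans (sol_N_ge1 sol). Qed.

Lemma sol_N_neq0 : N != 0. Proof. by rewrite gt_eqF// sol_N_gt0. Qed.

Local Notation V := (potential K u N).

Lemma continuous_sol : continuous u.
Proof. exact: (sol_smooth sol [::]).1. Qed.

Lemma has_lap_sol x : has_lap u x (- (V x * u x)).
Proof.
have u0 := sol_gt0 sol x.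
have := has_lap_smooth x (sol_smooth sol).
rewrite (_ : laplacian u x = - (V x * u x))//.
apply/eqP; rewrite -addr_eq0 /potential -mulrA -[X in _ `^ _ * X]powRr1 ?ltW//.
rewrite -powRDp// (_ : 4 / N + 1 = (N + 4) / N) ?(sol_eq sol)//.
by have := sol_N_neq0 => N0; field.
Qed.

(** The domain is unbounded, so d |x|^(-N/4) is added to the barrier. It decays more slowly than the
    bound on u and thus dominates u on a large sphere, whatever d > 0. It is also a strict
    supersolution, because (N/4) (3N/4) = 3 N^2 / 16 exceeds |x|^2 V. Finally d tends to 0. *)
Lemma exterior_comparison (e0 R1 A : R) (psi : 'rV[R]_n -> R) :
  0 < e0 -> 0 < R1 -> 0 <= A ->
  (forall x, R1 <= enorm x -> u x <= e0 * enorm x `^ (- (N / 2))) ->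
  (forall x, R1 <= enorm x ->
     V x < 3 / 16 * N ^+ 2 * enorm x `^ (- 2)) ->
  (forall x, R1 <= enorm x -> 0 < psi x) ->
  (forall x, R1 <= enorm x -> {for x, continuous psi}) ->
  (forall x, R1 < enorm x -> exists2 L, has_lap psi x L & L < - (V x * psi x)) ->
  (forall x, enorm x = R1 -> u x <= A * psi x) ->
  forall x, R1 <= enorm x -> u x <= A * psi x.
Proof.
move=> e00 R10 A0 u_e0 V_lt psi0 cpsi lap_psi u_psi x R1x.
have [Ngt0 u0] := (sol_N_gt0, sol_gt0 sol).
have x0 := lt_le_trans R10 R1x.
suff H d : 0 < d -> u x <= A * psi x + d * enorm x `^ (- (N / 4)).
  apply/ler_addgt0Pr => e e_gt0.
  have p0 : 0 < enorm x `^ (- (N / 4)) by exact: powR_gt0.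
  have := H (e / enorm x `^ (- (N / 4))); rewrite divfK ?gt_eqF//; apply.
  by rewrite divr_gt0.
move=> d0.
(* Beyond (e0 / d)^(4/N) the added term d |x|^(-N/4) overtakes e0 |x|^(-N/2); the summand |x| puts x
   into the truncated domain. *)
pose T := enorm x + (e0 / d) `^ (4 / N).
have e0d : 0 < e0 / d by rewrite divr_gt0.
have N4 : 0 < N / 4 by rewrite divr_gt0.
have T0 : 0 < T by rewrite /T ltr_wpDr// powR_ge0.
have TN : e0 / d <= T `^ (N / 4).
  rewrite -[leLHS](powRKl e0d (lt0r_neq0 N4)) invf_div.
  rewrite ge0_ler_powR ?nnegrE ?powR_ge0 ?(ltW N4) ?(ltW T0)//.
  by rewrite /T lerDr ltW.
pose D : set 'rV[R]_n := [set y | R1 <= enorm y] `&` [set y | enorm y <= T].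
pose phi y := A * psi y + d * enorm y `^ (- (N / 4)).
apply: (@comparison _ _ D u phi) => //.
- apply: (@enorm_bounded_closed_compact _ _ _ 0 T).
    apply: closedI.
      by apply: closed_fun_ge; exact: continuous_enorm0.
    by apply: closed_fun_le; exact: continuous_enorm0.
  by move=> y [_]; rewrite subr0.
- by apply: continuous_subspaceT; exact: continuous_sol.
- apply: continuous_in_subspaceT => y; rewrite inE => -[/= R1y _].
  have cA := continuousM (@cst_continuous _ _ A y) (cpsi _ R1y).
  have cd := continuousM (@cst_continuous _ _ d y)
    (@continuous_enorm_powR0 _ _ (- (N / 4)) y (lt_le_trans R10 R1y)).
  exact: (continuousD cA cd).
- move=> y [/= R1y _]; apply: ltr_wpDl; first by rewrite mulr_ge0// ltW// psi0.
  by rewrite mulr_gt0// powR_gt0// (lt_le_trans R10).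
- move=> y [/= R1y yT].
  have y0 := lt_le_trans R10 R1y.
  have [yR1|yR1] := eqVneq (enorm y) R1.
    left; rewrite (le_trans (u_psi _ yR1))// lerDl mulr_ge0 ?powR_ge0//.
    exact: ltW.
  have [yT'|yT'] := eqVneq (enorm y) T.
    left; rewrite (le_trans (u_e0 _ R1y))// yT'; apply: ler_wpDl.
      by rewrite mulr_ge0// ltW// psi0.
    rewrite (_ : - (N / 2) = - (N / 4) + - (N / 4)); last by field.
    rewrite powRDp// mulrA yT' ler_pM2r ?powR_gt0// powRN ler_pdivrMr ?powR_gt0//.
    by rewrite mulrC -ler_pdivrMr.
  have {}yR1 : R1 < enorm y by rewrite lt_neqAle eq_sym yR1.
  right; split.
    apply: filterI.
      by apply: nbhs_fun_ge => //; exact: continuous_enorm0.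
    by apply: nbhs_fun_le; [exact: continuous_enorm0|rewrite lt_neqAle yT'].
  have [L hL LV] := lap_psi _ yR1.
  have hq := has_lap_enorm0 (- (N / 4)) y0.
  exists (- (V y * u y)).
  eexists; split; [exact: has_lap_sol| |].
    exact: (has_lapD (has_lapZ A hL) (has_lapZ d hq)).
  move=> s s1 uy.
  rewrite uy [V y * _]mulrCA -[ltRHS]mulrN ltr_pM2l ?(lt_trans _ s1)//.
  rewrite /phi [V y * _]mulrDr [ltRHS]opprD.
  (* A may be 0, so the part in [psi] gives only a weak inequality; strictness comes from the part
     in d. *)
  apply: ler_ltD.
    by rewrite [V y * _]mulrCA -[leRHS]mulrN ler_wpM2l// ltW.
  rewrite [V y * _]mulrCA -[ltRHS]mulrN ltr_pM2l// powRDp//.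
  rewrite n2 (_ : - (N / 4) * (- (N / 4) + N) = - (3 / 16 * N ^+ 2)); last by field.
  rewrite mulNr ltrN2 mulrCA [V y * _]mulrC ltr_pM2l ?powR_gt0//.
  exact: V_lt.
- by split => //=; rewrite /T lerDl powR_ge0.
Qed.

End exterior_decay.

Section threshold.
Context {R : realType} {n : nat} {K u : 'rV[R]_n -> R} {N R0 a b : R}.
Context (sol : exterior_solution K u N R0 a b).

Let n2 : n%:R - 2 = N. Proof. by rewrite (sol_dim sol) addrK. Qed.

Local Notation V := (potential K u N).

Lemma potential_gt0 x : R0 <= enorm x -> 0 < V x.
Proof.
move=> /(sol_K_bounds sol)/andP[aK _]; rewrite mulr_gt0 ?powR_gt0 ?(sol_gt0 sol)//.
exact: lt_le_trans (sol_a_gt0 sol) aK.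
Qed.

Lemma potential_le (c p : R) x : 0 <= c -> R0 <= enorm x ->
  u x <= c * enorm x `^ (- p) ->
  V x <= b * c `^ (4 / N) * enorm x `^ (- (p * (4 / N))).
Proof.
move=> c0 R0x ux; have /andP[aK Kb] := sol_K_bounds sol R0x.
have u0 := ltW (sol_gt0 sol x).
rewrite -mulrA ler_pM ?powR_ge0//; first exact: le_trans (ltW (sol_a_gt0 sol)) aK.
rewrite -mulNr [enorm x `^ _]powRrM -powRM ?powR_ge0//.
have N4 : 0 <= 4 / N by rewrite divr_ge0// ltW// (sol_N_gt0 sol).
by apply: ge0_ler_powR => //; rewrite nnegrE// mulr_ge0// powR_ge0.
Qed.

(** In the last barrier |x|^-N is harmonic and alone leaves no room for V. Subtracting |x|^(-N-1/2)
    makes the Laplacian negative of order |x|^(-N-5/2), which beats V |x|^-N = O(|x|^(-N-3)). *)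
Lemma fast_decay_of_small (e0 R1 : R) :
  0 < e0 -> b * e0 `^ (4 / N) < 3 / 16 * N ^+ 2 -> R0 <= R1 ->
  (forall x, R1 <= enorm x -> u x <= e0 * enorm x `^ (- (N / 2))) ->
  exists C r : R, [/\ 0 < C, R0 <= r &
    forall x, r <= enorm x -> u x <= C * enorm x `^ (- N)].
Proof.
move=> e00 be0 R01 u_e0.
have [Nge1 Ngt0 Nn0] := And3 (sol_N_ge1 sol) (sol_N_gt0 sol) (sol_N_neq0 sol).
have R00 := sol_R0_gt0 sol; have R10 : 0 < R1 := lt_le_trans R00 R01.
have V_lt x : R1 <= enorm x -> V x < 3 / 16 * N ^+ 2 * enorm x `^ (- 2).
  move=> R1x; have x0 := lt_le_trans R10 R1x.
  have := potential_le (ltW e00) (le_trans R01 R1x) (u_e0 _ R1x).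
  rewrite (_ : N / 2 * (4 / N) = 2); last by field.
  by move=> /le_lt_trans; apply; rewrite ltr_pM2r// powR_gt0.
(* Chosen to make A |x|^(-3N/4) equal to e0 |x|^(-N/2) on the sphere of radius [R1]. *)
pose A := e0 * R1 `^ (N / 4).
have A0 : 0 < A by rewrite mulr_gt0// powR_gt0.
have uA : forall x, R1 <= enorm x -> u x <= A * enorm x `^ (- (3 / 4 * N)).
  apply: (exterior_comparison sol (psi := fun x => enorm x `^ (- (3 / 4 * N)))
    e00 R10 (ltW A0) u_e0 V_lt) => x R1x.
  - by rewrite powR_gt0// (lt_le_trans R10).
  - by apply: continuous_enorm_powR0; exact: lt_le_trans R1x.
  - have x0 := lt_trans R10 R1x.
    eexists; first exact: has_lap_enorm0.
    rewrite n2 (_ : - (3 / 4 * N) * (- (3 / 4 * N) + N) = - (3 / 16 * N ^+ 2));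
      last by field.
    rewrite powRDp// mulNr ltrN2 mulrCA [V x * _]mulrC ltr_pM2l ?powR_gt0//.
    by apply: V_lt; exact: ltW.
  - have R1x' : R1 <= enorm x by rewrite R1x.
    rewrite (le_trans (u_e0 _ R1x'))// /A R1x -mulrA -powRDp//.
    by rewrite (_ : N / 4 + - (3 / 4 * N) = - (N / 2))//; field.
pose B := b * A `^ (4 / N).
have B0 : 0 < B by rewrite mulr_gt0 ?(sol_b_gt0 sol)// powR_gt0.
(* Beyond [R2] one has |x|^(-1/2) <= 1 / (2 (B + 1)). This gives psi >= |x|^-N / 2, and B |x|^(-1/2)
   < 1/2, which lies below the coefficient (N + 1/2) / 2 of the Laplacian of psi. *)
pose R2 := R1 + (2 * (B + 1)) ^+ 2.
have R12 : R1 <= R2 by rewrite /R2 lerDl sqr_ge0.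
have R20 : 0 < R2 := lt_le_trans R10 R12.
have BB : 0 < 2 * (B + 1) by rewrite mulr_gt0// addr_gt0.
have hB (x : 'rV[R]_n) : R2 <= enorm x -> enorm x `^ (- 2^-1) <= (2 * (B + 1))^-1.
  move=> R2x; rewrite powRN powR12_sqrt ?enorm_ge0// lef_pV2 ?posrE//; last first.
    by rewrite sqrtr_gt0 (lt_le_trans R20).
  rewrite -[leLHS](ger0_norm (ltW BB)) -sqrtr_sqr.
  by rewrite ler_wsqrtr// (le_trans _ R2x)// /R2 lerDr ltW.
pose psi (x : 'rV[R]_n) := enorm x `^ (- N) - enorm x `^ (- N - 2^-1).
have psiE x : R2 <= enorm x ->
    psi x = enorm x `^ (- N) * (1 - enorm x `^ (- 2^-1)).
  by move=> R2x; rewrite /psi powRDp ?(lt_le_trans R20)// mulrBr mulr1.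
have h12 (x : 'rV[R]_n) : R2 <= enorm x -> enorm x `^ (- 2^-1) <= 2^-1.
  move=> /hB/le_trans; apply; rewrite lef_pV2 ?posrE ?mulr_gt0 ?addr_gt0//.
  by rewrite ler_peMr// lerDr ltW.
have h1 (x : 'rV[R]_n) : R2 <= enorm x -> enorm x `^ (- 2^-1) < 1.
  by move=> R2x; rewrite (le_lt_trans (h12 _ R2x))// invf_lt1// ltr1n.
have psi0 (x : 'rV[R]_n) : R2 <= enorm x -> 0 < psi x.
  move=> R2x; rewrite psiE//; apply: mulr_gt0; last by rewrite subr_gt0 h1.
  by rewrite powR_gt0// (lt_le_trans R20).
pose c2 := R2 `^ (- N) - R2 `^ (- N - 2^-1).
(* A point of the sphere turns the positivity of psi into that of the constant [c2], its value
   there. *)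
have [x2 x2R2] : exists x : 'rV[R]_n, enorm x = R2.
  have n_gt0 : (0 < n)%N.
    by rewrite -(ltr_nat R) (sol_dim sol) addr_gt0.
  exists (R2 *: delta_mx 0 (Ordinal n_gt0)).
  by rewrite enormZ enorm_delta mulr1 gtr0_norm.
have c20 : 0 < c2 by have := psi0 x2; rewrite /psi x2R2; apply.
pose A2 := e0 * R2 `^ (- (N / 2)) / c2.
have A20 : 0 < A2 by rewrite divr_gt0// mulr_gt0// powR_gt0.
exists A2, R2; split => //; first exact: le_trans R12.
suff uA2 : forall x, R2 <= enorm x -> u x <= A2 * psi x.
  move=> x R2x; rewrite (le_trans (uA2 _ R2x))// ler_pM2l//.
  by rewrite /psi lerBlDr lerDl powR_ge0.
apply: (exterior_comparison sol e00 R20 (ltW A20)) => x R2x.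
- by apply: u_e0; exact: le_trans R2x.
- by apply: V_lt; exact: le_trans R2x.
- exact: psi0.
- by apply: continuousB; apply: continuous_enorm_powR0; exact: lt_le_trans R2x.
- have {}R2x := ltW R2x; have x0 := lt_le_trans R20 R2x.
  have R1x := le_trans R12 R2x.
  eexists.
    by apply: has_lapB; exact: has_lap_enorm0.
  rewrite n2 addNr mulr0 mul0r sub0r ltrN2 psiE//.
  have Vx : V x <= B * enorm x `^ (- 3).
    have := potential_le (ltW A0) (le_trans R01 R1x) (uA _ R1x).
    by rewrite (_ : 3 / 4 * N * (4 / N) = 3)//; field.
  set h := enorm x `^ (- 2^-1).
  have h0 : 0 < h by rewrite powR_gt0.
  have e1 : enorm x `^ (- 3) = h * h * enorm x `^ (- 2).
    by rewrite /h -!powRDp//; congr powR; field.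
  rewrite powRDp// powRDp// -/h.
  set m := enorm x `^ (- N); have m0 : 0 < m by rewrite powR_gt0.
  set r2 := enorm x `^ (- 2); have r20 : 0 < r2 by rewrite powR_gt0.
  have hB' : B * h < 2^-1.
    have := hB _ R2x; rewrite -/h -(ler_pM2l B0) => /le_lt_trans; apply.
    rewrite ltr_pdivrMr ?mulr_gt0 ?addr_gt0// mulrA mulVf// mul1r.
    by rewrite ltrDl.
  have V0 := ltW (potential_gt0 (le_trans R01 R1x)).
  apply: (@le_lt_trans _ _ (B * (h * h * r2) * m)).
    rewrite -e1; apply: ler_pM => //.
      by rewrite mulr_ge0 ?(ltW m0)// subr_ge0 ltW// h1.
    by rewrite ler_piMr ?(ltW m0)// gerBl ltW.
  rewrite (_ : B * (h * h * r2) * m = (B * h) * (h * r2 * m)); last by ring.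
  rewrite (_ : (- N - 2^-1) * (- N - 2^-1 + N) * (m * h * r2) =
    (N + 2^-1) / 2 * (h * r2 * m)); last by field.
  rewrite ltr_pM2r ?mulr_gt0// (lt_le_trans hB')//.
  lra.
- by rewrite /psi R2x -/c2 divfK ?gt_eqF// -R2x u_e0// R2x.
Qed.

End threshold.

(** * Interior Lipschitz bound and Harnack inequality *)

Section interior_lipschitz.
Context {R : realType} {n : nat}.
Implicit Types (x y z : 'rV[R]_n) (i j : 'I_n).

Local Notation "''e_' i" := (delta_mx 0 i : 'rV[R]_n) (at level 8, i at level 2).

Lemma continuous_coordB z j : continuous (fun x => x 0 j - z 0 j).
Proof.
move=> x; apply: continuousB; last exact: cst_continuous.
exact: coord_continuous.
Qed.

Lemma continuous_coord_dist z j : continuous (fun x => `|x 0 j - z 0 j|).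
Proof.
move=> x; apply: (continuous_comp (@continuous_coordB z j x)).
exact: norm_continuous.
Qed.

(* Comparison on the half cube [0 <= T <= d], [T = eta (x_i - z_i)], of the odd
   part of v with the barrier of Gilbarg-Trudinger, Section 3.4:
   [(M / d^2) (\sum_(j != i) (x_j - z_j)^2 + T (n d - (n - 1) T)) + B T (d - T) / 2],
   whose Laplacian is - B. *)
Lemma reflect_difference_le (v : 'rV[R]_n -> R) i z (eta d M B : R) :
  eta ^+ 2 = 1 -> 0 < d -> 0 < M -> 0 < B -> continuous v ->
  (forall x, (forall j, `|x 0 j - z 0 j| <= d) ->
    [/\ 0 <= v x, v x <= M & exists L, [/\ has_lap v x L, - B < L & L <= 0]]) ->
  forall t, 0 <= t -> t <= d ->
  v (z + (eta * t) *: 'e_i) - v (z - (eta * t) *: 'e_i) <=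
    t * (n%:R * M / d + B * d / 2).
Proof.
move=> eta2 d0 M0 B0 cv Hv t t0 td.
have eta1 : `|eta| = 1.
  apply/eqP; rewrite -(@eqrXn2 _ 2) ?normr_ge0//.
  by rewrite expr1n real_normK ?num_real// eta2.
have dn0 : d != 0 by rewrite gt_eqF.
pose m := M / d ^+ 2.
have m0 : 0 < m by rewrite divr_gt0// exprn_gt0.
have md : M = m * d ^+ 2 by rewrite /m divfK// expf_neq0.
clearbody m.
pose N1 : R := n%:R - 1.
have N10 : 0 <= N1 by rewrite /N1 subr_ge0 ler1n; case: (n) i => // -[].
have nN : n%:R = N1 + 1 by rewrite /N1 subrK.
clearbody N1.
pose A j := if j == i then - (m * N1) - B / 2 else m.
pose C j := if j == i then eta * (n%:R * M / d + B * d / 2) else 0.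
pose w x := v x - v (reflect_coord z i x).
pose psi x := \sum_j (A j * (x 0 j - z 0 j) ^+ 2 + C j * (x 0 j - z 0 j) + 0).
pose T x := eta * (x 0 i - z 0 i).
pose D : set 'rV[R]_n := (\bigcap_(j in [set: 'I_n])
  [set x : 'rV[R]_n | `|x 0 j - z 0 j| <= d]) `&` [set x | 0 <= T x].
have cT : continuous T.
  move=> x; exact: (continuousM (@cst_continuous _ _ eta x) (@continuous_coordB z i x)).
have psiE x : psi x = \sum_(j | j != i) m * (x 0 j - z 0 j) ^+ 2 +
    (m * (T x * (n%:R * d - N1 * T x)) + B * (T x * (d - T x)) / 2).
  rewrite /psi (bigD1 i)//= addrC; congr (_ + _).
    by apply: eq_bigr => j /negPf ji; rewrite /A /C ji mul0r !addr0.
  rewrite /A /C eqxx md /T.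
  set s := x 0 i - z 0 i.
  have -> : m * (eta * s * (n%:R * d - N1 * (eta * s))) + B * (eta * s * (d - eta * s)) / 2 =
    m * (eta * s * n%:R * d - N1 * (eta ^+ 2 * s ^+ 2))
      + B * (eta * s * d - eta ^+ 2 * s ^+ 2) / 2 by ring.
  by rewrite eta2 !mul1r; field.
have S0 x : 0 <= \sum_(j | j != i) m * (x 0 j - z 0 j) ^+ 2.
  by apply: sumr_ge0 => j _; rewrite mulr_ge0 ?sqr_ge0// ltW.
have absT x : `|T x| = `|x 0 i - z 0 i| by rewrite /T normrM eta1 mul1r.
have T2 x : D x -> 0 <= T x <= d.
  by move=> [Dx Tx]; rewrite Tx /= -(ger0_norm Tx) absT; exact: Dx.
have P0 x : D x -> 0 <= m * (T x * (n%:R * d - N1 * T x)) /\ 0 <= B * (T x * (d - T x)) / 2.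
  move=> /T2/andP[Tx Txd]; split.
    rewrite mulr_ge0 ?(ltW m0)// mulr_ge0// nN subr_ge0 [(N1 + 1) * d]mulrDl mul1r.
    by rewrite ler_wpDr ?(ltW d0)// ler_wpM2l.
  by rewrite divr_ge0// mulr_ge0 ?(ltW B0)// mulr_ge0// subr_ge0.
have reflD x : (forall j, `|x 0 j - z 0 j| <= d) ->
    forall j, `|reflect_coord z i x 0 j - z 0 j| <= d.
  move=> Dx j; rewrite !mxE eqxx /=; have := Dx j.
  case: eqVneq => [->|ji]; last by rewrite mulr0 subr0.
  move=> H; apply: le_trans H; rewrite -normrN le_eqVlt; apply/orP; left; apply/eqP.
  by congr `|_|; rewrite /=; ring.
(* The barrier vanishes at z, whereas the comparison principle divides by it; hence the added
   constant, which tends to 0 afterwards. *)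
suff H de : 0 < de -> forall x, D x -> w x <= psi x + de.
  pose x := z + (eta * t) *: 'e_i.
  have xj j : x 0 j - z 0 j = if j == i then eta * t else 0.
    by rewrite !mxE eqxx /=; case: (j == i) => /=; ring.
  have Tx : T x = t by rewrite /T xj eqxx mulrA -expr2 eta2 mul1r.
  have Dx : D x.
    split; last by rewrite /= Tx.
    move=> j _ /=; rewrite xj; case: eqP => _; last by rewrite normr0 ltW.
    by rewrite normrM (ger0_norm t0) eta1 mul1r.
  have wx : w x = v (z + (eta * t) *: 'e_i) - v (z - (eta * t) *: 'e_i).
    rewrite /w; congr (_ - v _); apply/rowP => j.
    by rewrite /reflect_coord xj eqxx /x !mxE; ring.
  have psix : psi x <= t * (n%:R * M / d + B * d / 2).
    rewrite psiE big1 ?add0r => [|j /negPf ji]; last first.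
      by rewrite xj ji expr0n mulr0.
    rewrite Tx md; have -> : t * (n%:R * (m * d ^+ 2) / d + B * d / 2) =
      m * (t * (n%:R * d)) + B * (t * d) / 2 by field.
    have mt : 0 <= m * (t * (N1 * t)) by rewrite !mulr_ge0// ltW.
    have Bt : 0 <= B * (t * t) by rewrite !mulr_ge0// ltW.
    lra.
  rewrite -wx; apply: le_trans psix; apply/ler_addgt0Pr => e e0.
  exact: H.
move=> de0.
apply: comparison.
- apply: (@enorm_bounded_closed_compact _ _ _ z (n%:R * d)).
    apply: closedI; last exact: closed_fun_ge.
    apply: closed_bigI => j _.
    by apply: closed_fun_le; exact: continuous_coord_dist.
  move=> x [Dx _]; apply: enorm_le_coord; first exact: ltW.
  by move=> j; rewrite !mxE; exact: Dx.
- apply: continuous_subspaceT => x; apply: continuousB; first exact: cv.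
  have c1 := continuousM (@cst_continuous _ _ (2 : R) x) (@continuous_coordB z i x).
  have c2 := continuous_comp c1 (@scalel_continuous _ _ 'e_i _).
  have cid : {for x, continuous (@id 'rV[R]_n)} by exact: cvg_id.
  exact: (continuous_comp (continuousB cid c2) (@cv _)).
- apply: continuous_subspaceT => x; apply: continuousD; last exact: cst_continuous.
  have -> : psi = (\sum_j (fun x => A j * (x 0 j - z 0 j) ^+ 2 + C j * (x 0 j - z 0 j) + 0)).
    by apply/funext => y; rewrite fct_sumE.
  apply: (big_ind (fun f : 'rV[R]_n -> R => {for x, continuous f})).
  + exact: cst_continuous.
  + by move=> f g cf cg; exact: (continuousD cf cg).
  + move=> j _; have cj := @continuous_coordB z j x.
    apply: continuousD; last exact: cst_continuous.
    apply: continuousD; apply: continuousM; try exact: cst_continuous; last exact: cj.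
    exact: (continuousM cj cj).
- move=> x Dx; rewrite psiE; have [P1 P2] := P0 _ Dx; have := S0 x.
  by move=> S0x; rewrite ltr_wpDl// addr_ge0// addr_ge0.
- move=> x Dx; have [P1 P2] := P0 _ Dx; have S0x := S0 x.
  have /andP[Tx0 Txd] := T2 _ Dx.
  have Dx1 j : `|x 0 j - z 0 j| <= d by exact: Dx.1.
  have [vx0 vxM [L1 [hL1 L1B L10]]] := Hv _ Dx1.
  have [vy0 vyM [L2 [hL2 L2B L20]]] := Hv _ (reflD _ Dx1).
  (* Both values of v lie between 0 and M, so their difference is at most M, which the barrier
     attains on the faces T = d and |x_j - z_j| = d. On T = 0 the reflection fixes x. *)
  have wM : w x <= M by rewrite /w; lra.
  have [Tx0'|Txn0] := eqVneq (T x) 0.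
    left; rewrite /w (_ : reflect_coord z i x = x).
      by rewrite subrr psiE !addr_ge0// ltW.
    have xi0 : x 0 i - z 0 i = 0.
      by rewrite -[LHS]mul1r -eta2 expr2 -mulrA -/(T x) Tx0' mulr0.
    by rewrite /reflect_coord xi0 mulr0 scale0r subr0.
  have [Txd'|Txnd] := eqVneq (T x) d.
    left; apply: (le_trans wM); rewrite psiE Txd' nN md.
    rewrite (_ : m * (d * _) = m * d ^+ 2); last by ring.
    by rewrite subrr !mulr0 mul0r addr0 addrAC lerDr addr_ge0// ltW.
  have [/existsP[j /andP[ji xjd]]|] :=
      boolP [exists j, (j != i) && (`|x 0 j - z 0 j| == d)].
    left; apply: (le_trans wM); rewrite psiE md (bigD1 j)//=.
    rewrite -[(x 0 j - z 0 j) ^+ 2]real_normK ?num_real// (eqP xjd).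
    rewrite -!addrA lerDl !addr_ge0 ?(ltW de0)//.
    by apply: sumr_ge0 => k _; rewrite mulr_ge0 ?sqr_ge0// ltW.
  rewrite negb_exists => /forallP xjd; right; split.
    apply: filterI; last first.
      by apply: nbhs_fun_ge => //; rewrite lt_neqAle eq_sym Txn0.
    apply: (@filterS _ (nbhs x) _ [set y : 'rV[R]_n | forall j, `|y 0 j - z 0 j| <= d]).
      by move=> y Hy j _; exact: Hy.
    apply: (@filter_forall _ _ (fun j y => `|y 0 j - z 0 j| <= d) (nbhs x)) => j.
    apply: nbhs_fun_le.
      exact: continuous_coord_dist.
    rewrite lt_neqAle Dx1 andbT; have := xjd j; rewrite negb_and negbK.
    case: eqVneq => //= -> _.
    apply: contra_neq Txnd => xid; apply/eqP.
    by rewrite -(ger0_norm Tx0) absT xid.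
  exists (L1 - L2), (\sum_j 2 * A j + 0); split.
  + apply: has_lapB => //; exact: has_lap_reflect.
  + apply: has_lapD; last exact: has_lap_cst.
    by apply: has_lap_sum => j; exact: has_lap_coord.
  (* The Laplacian of w is L1 - L2 > - B, because L1 > - B and L2 <= 0. *)
  + move=> s s1 _.
    rewrite (bigD1 i)//= (eq_bigr (fun=> 2 * m)); last first.
      by move=> j /negPf ji; rewrite /A ji.
    rewrite sumr_const /A eqxx.
    have -> : #|(fun j => j != i)| = n.-1 by rewrite cardC1 card_ord.
    rewrite -[_ *+ n.-1]mulr_natr.
    have -> : (n.-1)%:R = N1.
      by apply: (addIr 1); rewrite -nN natr1 prednK// (leq_ltn_trans _ (ltn_ord i)).
    rewrite (_ : 2 * (- (m * N1) - B / 2) + 2 * m * N1 + 0 = - B); last by field.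
    have : s * - B < - B by rewrite mulrN ltrN2 ltr_pMl.
    lra.
Qed.

End interior_lipschitz.

Section cube_oscillation.
Context {R : realType} {n : nat}.

(** Pass from y0 to y one coordinate at a time. Each step compares two points symmetric about their
    midpoint, at distance at most rho / 2 from it. The midpoints stay within rho <= d of y0 in every
    coordinate, hence the cube of half-side 2 d. *)
Lemma cube_oscillation (v : 'rV[R]_n -> R) (y0 y : 'rV[R]_n) (d M B rho : R) :
  0 < d -> 0 < M -> 0 < B -> 0 <= rho -> rho <= d -> continuous v ->
  (forall x : 'rV[R]_n, (forall j, `|x 0 j - y0 0 j| <= 2 * d) ->
    [/\ 0 <= v x, v x <= M & exists L, [/\ has_lap v x L, - B < L & L <= 0]]) ->
  (forall j, `|y 0 j - y0 0 j| <= rho) ->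
  v y0 - v y <= n%:R * (rho / 2 * (n%:R * M / d + B * d / 2)).
Proof.
move=> d0 M0 B0 rho0 rhod cv Hv yy0.
set Lam := n%:R * M / d + B * d / 2.
have Lam0 : 0 <= Lam.
  by rewrite addr_ge0// ?divr_ge0 ?mulr_ge0// ltW.
pose p k : 'rV[R]_n := \row_j (if (j < k)%N then y 0 j else y0 0 j).
suff H k : (k <= n)%N -> v y0 - v (p k) <= k%:R * (rho / 2 * Lam).
  have := H _ (leqnn n); rewrite (_ : p n = y)//.
  by apply/rowP => j; rewrite mxE ltn_ord.
elim: k => [_|k IH kn].
  rewrite mul0r (_ : p 0%N = y0) ?subrr//.
  by apply/rowP => j; rewrite mxE.
pose i := Ordinal kn.
pose h := y 0 i - y0 0 i.
(* With z the midpoint of [p k] and [p k.+1], the sign [eta] points from z towards [p k]. *)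
pose eta : R := if h <= 0 then 1 else -1.
have eta2 : eta ^+ 2 = 1 by rewrite /eta; case: ifP => _; rewrite ?sqrrN expr1n.
have etah : eta * (`|h| / 2) = - (h / 2).
  rewrite /eta; case: ifPn => [h0|]; first by rewrite ler0_norm// mul1r mulNr.
  by rewrite -ltNge => h0; rewrite gtr0_norm// mulN1r.
pose z := p k + (h / 2) *: delta_mx 0 i.
have pk j : `|z 0 j - y0 0 j| <= rho.
  rewrite !mxE eqxx /=; have [->|ji] := eqVneq j i.
    rewrite /= ltnn mulr1 addrC addKr normrM [`|2^-1|]ger0_norm//.
    by rewrite -[leRHS]mulr1 ler_pM// ?yy0// invf_le1// ler1n.
  rewrite mulr0 addr0; case: ifP => _; first exact: yy0.
  by rewrite subrr normr0.
have hr : `|h| / 2 <= rho / 2 by rewrite ler_pM2r// yy0.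
have Hz1 (x : 'rV[R]_n) : (forall j, `|x 0 j - z 0 j| <= d) ->
    [/\ 0 <= v x, v x <= M & exists L, [/\ has_lap v x L, - B < L & L <= 0]].
  move=> xz; apply: Hv => j.
  rewrite -(subrKA (z 0 j)) (le_trans (ler_normD _ _))//.
  by rewrite mulr_natl mulr2n lerD// (le_trans (pk j)).
have Hz2 : 0 <= `|h| / 2 by rewrite divr_ge0.
have Hz3 : `|h| / 2 <= d.
  by rewrite (le_trans hr)// ler_pdivrMr// (le_trans rhod)// ler_peMr ?ler1n// ltW.
have := reflect_difference_le i eta2 d0 M0 B0 cv Hz1 Hz2 Hz3; rewrite etah.
rewrite -/Lam => Hz.
have E1 : z + (- (h / 2)) *: delta_mx 0 i = p k.
  by rewrite /z scaleNr addrK.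
have E2 : z - (- (h / 2)) *: delta_mx 0 i = p k.+1.
  rewrite scaleNr opprK /z -addrA -scalerDl -splitr.
  apply/rowP => j; rewrite !mxE eqxx /= ltnS [in RHS]leq_eqVlt.
  have [->|ji] := eqVneq j i; first by rewrite /= eqxx ltnn mulr1 addrC subrK.
  by rewrite mulr0 addr0 (_ : (val j == k) = false)//; apply/negbTE.
move: Hz; rewrite E1 E2 => Hz.
have := IH (ltnW kn).
have : `|h| / 2 * Lam <= rho / 2 * Lam by rewrite ler_wpM2r.
rewrite -[k.+1%:R]natr1 mulrDl mul1r; lra.
Qed.

End cube_oscillation.

Section harnack.
Context {R : realType} {n : nat} {K u : 'rV[R]_n -> R} {N R0 a b Cs : R}.
Context (sol : exterior_solution K u N R0 a b) (Cs_gt0 : 0 < Cs).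
Context (slow : forall x, R0 <= enorm x -> u x <= Cs * enorm x `^ (- (N / 2))).

Let n2 : n%:R - 2 = N. Proof. by rewrite (sol_dim sol) addrK. Qed.

Local Notation V := (potential K u N).

(** At distance about r, u is at most of order r^(-N/2) and its Laplacian of order r^(-2-N/2). The
    oscillation over a cube of half-side k r is then at most a constant times k r^(-N/2), and a
    small k makes it at most half of the value at the centre. *)
Lemma cube_lower_bound (e0 : R) : 0 < e0 -> exists k : R, 0 < k < 1 /\
  forall y, 2 * R0 <= enorm y -> e0 * enorm y `^ (- (N / 2)) <= u y ->
  forall x : 'rV[R]_n, (forall j, `|x 0 j - y 0 j| <= k * enorm y) ->
  e0 / 2 * enorm y `^ (- (N / 2)) <= u x.
Proof.
move=> e00.
have [Nge1 Ngt0 Nn0] := And3 (sol_N_ge1 sol) (sol_N_gt0 sol) (sol_N_neq0 sol).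
have R00 := sol_R0_gt0 sol; have b0 := sol_b_gt0 sol.
have n1 : 1 < n%:R :> R by rewrite (sol_dim sol) ltr_wpDl// ?ltr1n// ltW.
have n0 : 0 < n%:R :> R by rewrite (lt_trans _ n1).
(* The summand 1 makes the lower bound on the Laplacian strict. *)
pose B0 := b * Cs `^ (4 / N) + 1.
have B00 : 0 < B0 by rewrite addr_gt0// mulr_gt0// powR_gt0.
(* The factor 2^(N/2) accounts for points of norm r / 2, the smallest in the cube. *)
pose M0 := Cs * 2 `^ (N / 2).
have M00 : 0 < M0 by rewrite mulr_gt0// powR_gt0.
pose L0 := 4 * n%:R ^+ 2 + B0 / (2 * n%:R).
have L00 : 0 < L0 by rewrite addr_gt0// ?divr_gt0 ?mulr_gt0// exprn_gt0.
pose k0 := e0 / (n%:R * L0 * M0).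
have k00 : 0 < k0 by rewrite divr_gt0// !mulr_gt0.
exists (Num.min (4 * n%:R)^-1 k0).
set k := Num.min _ _.
have k_gt0 : 0 < k by rewrite lt_min k00 invr_gt0 mulr_gt0.
have k4 : k <= (4 * n%:R)^-1 by rewrite ge_min lexx.
split.
  rewrite k_gt0 (le_lt_trans k4)// invf_lt1 ?mulr_gt0//.
  by rewrite (lt_trans n1)// ltr_pMl// ltr1n.
move=> y Ry uy x xy.
have r0 : 0 < enorm y by rewrite (lt_le_trans _ Ry)// mulr_gt0.
set r := enorm y in Ry uy xy r0 *.
(* The cube of half-side 2 d then lies in the Euclidean ball of radius n (2 d) = r / 2 about y. *)
pose d := r / (4 * n%:R).
have d0 : 0 < d by rewrite divr_gt0// mulr_gt0.
pose M := M0 * r `^ (- (N / 2)).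
have Mgt0 : 0 < M by rewrite mulr_gt0// powR_gt0.
pose B := B0 * 4 * r ^- 2 * M.
have rV2 : 0 < r ^- 2 by rewrite invr_gt0 exprn_gt0.
have Bgt0 : 0 < B.
  by rewrite /B; do 3?[apply: mulr_gt0 => //].
have kr0 : 0 <= k * r by rewrite mulr_ge0 ?ltW.
have krd : k * r <= d by rewrite /d mulrC ler_wpM2l ?(ltW r0).
suff Hu (w : 'rV[R]_n) : (forall j, `|w 0 j - y 0 j| <= 2 * d) ->
    [/\ 0 <= u w, u w <= M & exists L, [/\ has_lap u w L, - B < L & L <= 0]].
  have := cube_oscillation d0 Mgt0 Bgt0 kr0 krd (continuous_sol sol) Hu xy.
  set Q := n%:R * (_ * _) => H.
  suff : Q <= e0 / 2 * r `^ (- (N / 2)) by lra.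
  have -> : Q = k * (n%:R * L0 * M0) / 2 * r `^ (- (N / 2)).
    by rewrite /Q /B /M /L0 /d; field; rewrite !gt_eqF.
  rewrite ler_pM2r ?powR_gt0// ler_pM2r// -ler_pdivlMr ?mulr_gt0//.
  by rewrite ge_min lexx orbT.
move=> wy; have wr : r / 2 <= enorm w.
  have : enorm (y - w) <= n%:R * (2 * d).
    apply: enorm_le_coord; first by rewrite mulr_ge0// ltW.
    by move=> j; rewrite !mxE distrC.
  have -> : n%:R * (2 * d) = r / 2 by rewrite /d; field; rewrite gt_eqF.
  by have := enormD (y - w) w; rewrite subrK -/r; lra.
  have R0w : R0 <= enorm w by rewrite (le_trans _ wr)// ler_pdivlMr// mulrC.
  have r20 : 0 < r / 2 by rewrite divr_gt0.
  have uM : u w <= M.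
    rewrite (le_trans (slow R0w))// /M /M0 -mulrA ler_pM2l//.
    apply: (le_trans (le0_ler_powR _ r20 wr)).
      by rewrite oppr_le0 divr_ge0// ltW.
    rewrite powRM ?invr_ge0// ?(ltW r0)// mulrC ler_pM2r ?powR_gt0//.
    by rewrite -powR_inv1// -powRrM mulN1r opprK.
  split; [exact/ltW/(sol_gt0 sol)|exact: uM|].
  have Vw := potential_gt0 sol R0w.
  have uw := sol_gt0 sol w.
  exists (- (V w * u w)); split; first exact: has_lap_sol sol w.
    have w2 : enorm w `^ (- 2) <= 4 * r ^- 2.
      apply: (le_trans (le0_ler_powR _ r20 wr)); first by rewrite oppr_le0.
      by rewrite powR_invn ?(ltW r20)// expr_div_n invf_div -natrX.
    have bC : 0 < b * Cs `^ (4 / N) by rewrite mulr_gt0// powR_gt0.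
    have Vlt : V w < B0 * 4 * r ^- 2.
      have := potential_le sol (ltW Cs_gt0) R0w (slow R0w).
      rewrite (_ : N / 2 * (4 / N) = 2); last by field.
      move=> /le_lt_trans; apply; rewrite -[ltRHS]mulrA.
      apply: (@le_lt_trans _ _ (b * Cs `^ (4 / N) * (4 * r ^- 2))).
        by rewrite ler_pM2l.
      by rewrite ltr_pM2r ?ltrDl// mulr_gt0.
    rewrite ltrN2 /B; apply: (@le_lt_trans _ _ (V w * M)).
      by rewrite ler_pM2l.
    by rewrite ltr_pM2r.
  by rewrite oppr_le0 mulr_ge0 ?ltW.
Qed.

End harnack.

Section annulus.
Context {R : realType} {n : nat} {K u : 'rV[R]_n -> R} {N R0 a b Cs : R}.
Context (sol : exterior_solution K u N R0 a b) (Cs_gt0 : 0 < Cs).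
Context (slow : forall x, R0 <= enorm x -> u x <= Cs * enorm x `^ (- (N / 2))).

Let n2 : n%:R - 2 = N. Proof. by rewrite (sol_dim sol) addrK. Qed.

Local Notation V := (potential K u N).

(** The barrier is harmonic and u is strictly superharmonic where |w| >= r / 4 >= R0. On the sphere
    |w| = r / 4 one has |w - y| >= 3 |w|, so the factor 3^-N makes the barrier nonpositive there,
    and no information on u is needed on that sphere. Lowering the barrier by d makes it nonpositive
    far away as well. *)
Lemma annulus_barrier (y : 'rV[R]_n) (rho c0 : R) :
  4 * R0 <= enorm y -> 0 < rho -> 0 < c0 ->
  (forall x, enorm (x - y) = rho -> c0 * rho `^ (- N) <= u x) ->
  forall x, enorm y <= enorm x -> rho <= enorm (x - y) ->
  c0 * (enorm (x - y) `^ (- N) - 3 `^ (- N) * enorm x `^ (- N)) <= u x.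
Proof.
move=> Ry rho0 c00 uy x yx rhox.
have [Ngt0 R00] := (sol_N_gt0 sol, sol_R0_gt0 sol).
have r0 : 0 < enorm y by rewrite (lt_le_trans _ Ry)// mulr_gt0.
set r := enorm y in Ry yx r0 *.
have NN : - N <= 0 by rewrite oppr_le0 ltW.
pose h w : R := c0 * (enorm (w - y) `^ (- N) - 3 `^ (- N) * enorm w `^ (- N)).
suff H d : 0 < d -> h x - d <= u x.
  by apply/ler_addgt0Pr => d /H; rewrite lerBlDr.
move=> d0.
(* On the sphere of radius T one has |w - y| >= (c0 / d)^(1/N), hence c0 |w - y|^-N <= d. *)
pose T := enorm x + r + (c0 / d) `^ (N^-1).
have cd0 : 0 < c0 / d by rewrite divr_gt0.
have p0 : 0 < (c0 / d) `^ (N^-1) by rewrite powR_gt0.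
pose D : set 'rV[R]_n := [set w | r / 4 <= enorm w] `&`
  ([set w | enorm w <= T] `&` [set w | rho <= enorm (w - y)]).
have cD : compact D.
  apply: (@enorm_bounded_closed_compact _ _ _ 0 T).
    apply: closedI; first by apply: closed_fun_ge; exact: continuous_enorm0.
    apply: closedI; first by apply: closed_fun_le; exact: continuous_enorm0.
    by apply: closed_fun_ge; exact: continuous_enorm.
  by move=> w [_ []]; rewrite subr0.
have w0 w : D w -> 0 < enorm w.
  by move=> [rw _]; rewrite (lt_le_trans _ rw)// divr_gt0.
have wy0 w : D w -> 0 < enorm (w - y) by move=> [_ [_]]; exact: lt_le_trans.
(* Here u is the majorant and the lowered barrier the function to be bounded. *)
apply: (@comparison _ _ D (fun w => h w - d) u) => //.
- apply: continuous_in_subspaceT => w; rewrite inE => Dw.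
  have c1 := @continuous_enorm_powR _ _ _ (- N) _ (wy0 _ Dw).
  have c2 := continuousM (@cst_continuous _ _ (3 `^ (- N) : R) w)
    (@continuous_enorm_powR0 _ _ (- N) _ (w0 _ Dw)).
  have c3 := continuousM (@cst_continuous _ _ c0 w) (continuousB c1 c2).
  exact: (continuousB c3 (@cst_continuous _ _ d w)).
- by apply: continuous_subspaceT; exact: continuous_sol sol.
- by move=> w _; exact: sol_gt0 sol w.
- move=> w Dw; have [/= rw [wT wrho]] := Dw.
  have u0 := sol_gt0 sol w.
  have [wr|wr] := eqVneq (enorm w) (r / 4).
    left; suff : h w <= 0 by lra.
    rewrite pmulr_rle0// subr_le0 -powRM ?enorm_ge0//.
    apply: le0_ler_powR => //; first by rewrite mulr_gt0// w0.
    by have := enormD (y - w) w; rewrite subrK enormB -/r wr; lra.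
  have [wr'|wr'] := eqVneq (enorm (w - y)) rho.
    left; rewrite (le_trans _ (uy _ wr'))// /h wr'.
    rewrite mulrBr !lerBlDr -addrA lerDl addr_ge0 ?(ltW d0)//.
    by rewrite mulr_ge0 ?(ltW c00)// mulr_ge0 ?powR_ge0.
  have [wT'|wT'] := eqVneq (enorm w) T.
    left; suff : h w <= d by lra.
    apply: (@le_trans _ _ (c0 * enorm (w - y) `^ (- N))).
      by rewrite ler_pM2l// gerBl mulr_ge0 ?powR_ge0.
    have wyT : (c0 / d) `^ (N^-1) <= enorm (w - y).
      have := enormD (w - y) y; rewrite subrK -/r wT' /T.
      by have := enorm_ge0 x; lra.
    rewrite powRN ler_pdivrMr ?powR_gt0 ?wy0// mulrC -ler_pdivrMr//.
    rewrite -(powRKl cd0 (sol_N_neq0 sol)).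
    by apply: ge0_ler_powR => //; rewrite ?nnegrE ?enorm_ge0 ?ltW.
  right; split.
    apply: filterI.
      apply: nbhs_fun_ge; first exact: continuous_enorm0.
      by rewrite lt_neqAle eq_sym wr.
    apply: filterI.
      apply: nbhs_fun_le; first exact: continuous_enorm0.
      by rewrite lt_neqAle wT'.
    apply: nbhs_fun_ge; first exact: continuous_enorm.
    by rewrite lt_neqAle eq_sym wr'.
  exists (c0 * (0 - 3 `^ (- N) * 0) - 0), (- (V w * u w)); split.
  + apply: has_lapB; last exact: has_lap_cst.
    apply: has_lapZ; apply: has_lapB; last apply: has_lapZ.
      have := has_lap_enorm (- N) (wy0 _ Dw).
      by rewrite n2 addNr mulr0 mul0r.
    have := has_lap_enorm0 (- N) (w0 _ Dw).
    by rewrite n2 addNr mulr0 mul0r.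
  + exact: has_lap_sol sol w.
  + move=> s s1 _; rewrite mulr0 subrr mulr0 subrr.
    rewrite pmulr_rlt0 ?(lt_trans _ s1)// oppr_lt0 mulr_gt0//.
    apply: (potential_gt0 sol); rewrite (le_trans _ rw)//; lra.
- split => /=; first by lra.
  split => //; rewrite /T; lra.
Qed.

(** Inside the ball of radius k r about y this is [cube_lower_bound]. Outside it, |x - y| <= 2 |x|
    bounds the barrier below by c0 q |x|^-N, with q = 2^-N - 3^-N > 0; the powers of r combine to
    r^(-N/2) again. *)
Lemma annulus_lower_bound (e0 : R) : 0 < e0 -> exists2 c1 : R, 0 < c1 &
  forall y, 4 * R0 <= enorm y -> e0 * enorm y `^ (- (N / 2)) <= u y ->
  forall x, enorm y <= enorm x -> enorm x <= 2 * enorm y ->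
  c1 * enorm y `^ (- (N / 2)) <= u x.
Proof.
move=> e00.
have [k [/andP[k0 _] Hk]] := cube_lower_bound sol Cs_gt0 slow e00.
have [Ngt0 R00] := (sol_N_gt0 sol, sol_R0_gt0 sol).
have NN : - N <= 0 by rewrite oppr_le0 ltW.
pose q : R := 2 `^ (- N) - 3 `^ (- N).
have q0 : 0 < q.
  rewrite subr_gt0 !powRN ltf_pV2 ?posrE ?powR_gt0//.
  by apply: gt0_ltr_powR; rewrite ?nnegrE// ltr_nat.
pose c1 := Num.min (e0 / 2) (e0 / 2 * k `^ N * q * 2 `^ (- N)).
have c10 : 0 < c1.
  by rewrite lt_min divr_gt0//= !mulr_gt0 ?powR_gt0// divr_gt0.
exists c1 => // y Ry uy x yx xy.
have r0 : 0 < enorm y by rewrite (lt_le_trans _ Ry)// mulr_gt0.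
have {}Hk := Hk y _ uy.
have {}Hk w : enorm (w - y) <= k * enorm y ->
    e0 / 2 * enorm y `^ (- (N / 2)) <= u w.
  move=> wy; apply: Hk; first by rewrite (le_trans _ Ry)// ler_pM2r// ler_nat.
  by move=> j; have := coord_le_enorm (w - y) j; rewrite !mxE => /le_trans; apply.
set r := enorm y in Ry uy yx xy r0 Hk *.
have kr : 0 < k * r by rewrite mulr_gt0.
have [/Hk xk|/ltW xk] := lerP (enorm (x - y)) (k * r).
  by rewrite (le_trans _ xk)// ler_pM2r ?powR_gt0// ge_min lexx.
(* Normalised so that c0 (k r)^-N is the lower bound known on the sphere of radius k r about y. *)
pose c0 := e0 / 2 * r `^ (- (N / 2)) * (k * r) `^ N.
have c00 : 0 < c0 by rewrite !mulr_gt0 ?powR_gt0// divr_gt0.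
have := @annulus_barrier y (k * r) c0 Ry kr c00.
have -> : c0 * (k * r) `^ (- N) = e0 / 2 * r `^ (- (N / 2)).
  by rewrite /c0 [(k * r) `^ (- N)]powRN mulfK// gt_eqF// powR_gt0.
move=> /(_ _ x yx xk) H; apply: le_trans (H _); last by move=> w wk; apply: Hk; rewrite wk.
have x0 : 0 < enorm x := lt_le_trans r0 yx.
have x2 : (2 * enorm x) `^ (- N) <= enorm (x - y) `^ (- N).
  apply: le0_ler_powR => //; first exact: lt_le_trans xk.
  by have := enormD x (- y); rewrite enormN -/r; lra.
apply: (@le_trans _ _ (c0 * (q * enorm x `^ (- N)))); last first.
  rewrite ler_pM2l// /q mulrBl lerD2r (le_trans _ x2)//.
  by rewrite powRM ?enorm_ge0.
apply: (@le_trans _ _ (c0 * (q * (2 * r) `^ (- N)))); last first.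
  by rewrite ler_pM2l// ler_pM2l// le0_ler_powR.
have -> : c0 * (q * (2 * r) `^ (- N)) =
    e0 / 2 * k `^ N * q * 2 `^ (- N) * r `^ (- (N / 2)).
  rewrite /c0 !powRM ?(ltW k0) ?(ltW r0)// (powRN r N).
  have rN : r `^ N != 0 by rewrite gt_eqF// powR_gt0.
  by field.
by rewrite ler_pM2r ?powR_gt0// ge_min lexx orbT.
Qed.

End annulus.

(** * Bounds on the conformal distance *)

Section integral_monotonicity.
Context d (T : measurableType d) {R : realType} (mu : {measure set T -> \bar R}).
Import HBNNSimple.

(* Unlike [ge0_le_integral], measurability is not required: the integral of a
   nonnegative function is a supremum over the simple functions below it. *)
Lemma ge0_le_integral_nonmeasurable (D : set T) (f g : T -> \bar R) :
  (forall x, D x -> 0 <= f x)%E -> (forall x, D x -> f x <= g x)%E ->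
  (\int[mu]_(x in D) f x <= \int[mu]_(x in D) g x)%E.
Proof.
move=> f0 fg; rewrite !ge0_integralE//; last first.
  by move=> x Dx; exact: le_trans (f0 _ Dx) (fg _ Dx).
apply: le_ereal_sup => _ [h /= hf <-]; exists h => //= x.
by apply: (le_trans (hf x)); apply: lee_restrict.
Qed.

End integral_monotonicity.

Section curve_calculus.
Context {R : realType} {n : nat}.
Implicit Types (c d : R -> 'rV[R]_n) (z : 'rV[R]_n).

Lemma within_continuous_comp (A : set R) (V W : topologicalType) (c : R -> V)
    (g : V -> W) :
  {within A, continuous c} -> continuous g -> {within A, continuous (g \o c)}.
Proof. by move=> cc cg x; exact: (continuous_comp (cc x) (cg _)). Qed.

Lemma within_continuousM (A : set R) (f g : R -> R) :
  {within A, continuous f} -> {within A, continuous g} ->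
  {within A, continuous (fun t => f t * g t)}.
Proof. by move=> cf cg x; exact: (continuousM (cf x) (cg x)). Qed.

Lemma within_continuous_edot (A : set R) c d :
  {within A, continuous c} -> {within A, continuous d} ->
  {within A, continuous (fun t => edot (c t) (d t))}.
Proof.
move=> cc cd; have -> : (fun t => edot (c t) (d t)) =
    (\sum_(i < n) fun t => c t 0 i * d t 0 i).
  by apply/funext => y; rewrite fct_sumE.
apply: (big_ind (fun f : R -> R => {within A, continuous f})).
- by move=> x; exact: cst_continuous.
- by move=> f g cf cg x; exact: (continuousD (cf x) (cg x)).
- move=> i _; apply: within_continuousM.
    exact: (within_continuous_comp cc (@coord_continuous R 1 n 0 i)).
  exact: (within_continuous_comp cd (@coord_continuous R 1 n 0 i)).
Qed.

Lemma is_derive_edot c d z (t : R) : is_derive t 1 c (d t) ->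
  is_derive t (1 : R) (fun s => edot (c s - z) (c s - z)) (2 * edot (c t - z) (d t)).
Proof.
move=> [dc dv].
have dci i : is_derive t (1 : R) (fun s => c s 0 i) (d t 0 i).
  split; first exact: (derivable_mxP c t 1).1 dc 0 i.
  by rewrite -dv derive_mx// mxE.
have -> : (fun s => edot (c s - z) (c s - z)) =
    (\sum_(i < n) (((fun s => c s 0 i) - cst (z 0 i)) * ((fun s => c s 0 i) - cst (z 0 i)))).
  by apply/funext => s; rewrite fct_sumE; apply: eq_bigr => i _; rewrite !mxE.
have -> : 2 * edot (c t - z) (d t) = \sum_(i < n) (2 * ((c t 0 i - z 0 i) * d t 0 i)).
  by rewrite mulr_sumr; apply: eq_bigr => i _; rewrite !mxE.
apply: is_derive_sum => i.
have h := is_deriveB (dci i) (is_derive_cst (z 0 i) t 1).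
apply: (@trigger_derive _ _ _ _ _ (is_deriveM h h)).
rewrite /GRing.scale /= subr0.
have -> : ((fun s : R => c s 0 i) - cst (z 0 i)) t = c t 0 i - z 0 i by [].
by ring.
Qed.

Lemma is_derive_scalel (f : R -> R) (df t : R) (v : 'rV[R]_n) :
  is_derive t (1 : R) f df -> is_derive t (1 : R) (fun s => f s *: v) (df *: v).
Proof.
move=> fdf.
have dij i j : is_derive t (1 : R) (fun s => (f s *: v) i j) (df * v i j).
  have -> : (fun s => (f s *: v) i j) = (v i j) \*: f.
    by apply/funext => s; rewrite mxE mulrC.
  by rewrite mulrC; exact: is_deriveZ.
have D : derivable (fun s => f s *: v) t 1.
  by apply/derivable_mxP => i j; have [] := dij i j.
split => //; rewrite derive_mx//; apply/matrixP => i j; rewrite !mxE.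
by have [_ ->] := dij i j.
Qed.

(** The square root of the conformal weight: a vector v at x has g-length W x times its Euclidean
    norm, and the volume density is W^n. *)
Definition conformal_factor (u : 'rV[R]_n -> R) (x : 'rV[R]_n) : R :=
  u x `^ (2 / (n%:R - 2)).

End curve_calculus.

Section distance_lower_bound.
Context {R : realType} {n : nat} {u : 'rV[R]_n -> R}.
Context (u_cont : continuous u) (u_pos : forall x, 0 < u x).
Implicit Types (c d : R -> 'rV[R]_n) (x y z : 'rV[R]_n).

Local Notation g := (conformal_metric u).

Local Notation W := (conformal_factor u).

Lemma conformal_factor_gt0 x : 0 < W x.
Proof. exact: powR_gt0. Qed.

Lemma continuous_conformal_factor : continuous W.
Proof.
move=> x.
exact: (continuous_comp (@u_cont x) (@continuous_powR _ (2 / (n%:R - 2)) _ (u_pos x))).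
Qed.

Lemma sqrt_conformal_metric x v : Num.sqrt (g x v v) = W x * enorm v.
Proof.
rewrite /conformal_metric sqrtrM ?powR_ge0//; congr (_ * _).
rewrite -powR12_sqrt ?powR_ge0// -powRrM; congr powR.
by rewrite mulrAC; congr (_ / _); lra.
Qed.

Context (theta dtheta : R -> R) (z : 'rV[R]_n).
Context (theta_derive : forall s, is_derive s (1 : R) theta (dtheta s)).
Context (dtheta_cont : continuous dtheta).
Context (dtheta_le : forall x,
  `|dtheta (edot (x - z) (x - z))| * (2 * enorm (x - z)) <= W x).

Let phi c (t : R) := theta (edot (c t - z) (c t - z)).

Let speed c (t : R) : \bar R := (Num.sqrt (g (c t) (derive1 c t) (derive1 c t)))%:E.

(** The function theta(|x - z|^2) has Euclidean gradient of norm |theta'| 2 |x - z| <= W, so it is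
    1-Lipschitz for g and its increment along a curve bounds the length from below. The squared norm
    keeps it differentiable at z. *)
Lemma C1_length_ge (a b : R) c : a < b -> C1_on a b c ->
  ((phi c b - phi c a)%:E <= \int[lebesgue_measure]_(t in `[a, b]) speed c t)%E /\
  measurable_fun `[a, b] (speed c).
Proof.
move=> ab [cc [d [cd dc]]].
pose E t := W (c t) * enorm (d t).
have cE : {within `[a, b], continuous E}.
  apply: within_continuousM.
    exact: (within_continuous_comp cc continuous_conformal_factor).
  exact: (within_continuous_comp cd continuous_enorm0).
(* At the end points [derive1 c] may differ from d; the passage back to the closed interval uses
   that they form a null set. *)
have speedE t : t \in `]a, b[ -> speed c t = (E t)%:E.
  move=> tab; rewrite /speed sqrt_conformal_metric /E.
  by rewrite derive1E; have [_ ->] := dc _ tab.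
have mS : measurable_fun `]a, b[ (speed c).
  apply: (eq_measurable_fun (EFin \o E)) => [t|].
    by rewrite inE => /= tab; rewrite speedE.
  apply/measurable_EFinP; apply: subspace_continuous_measurable_fun => //.
  by apply: continuous_subspaceW cE; exact: subset_itv_oo_cc.
split; last exact: (emeasurable_fun_itv_cc mS).
pose dphi t := dtheta (edot (c t - z) (c t - z)) * (2 * edot (c t - z) (d t)).
have ccz : {within `[a, b], continuous (fun t => c t - z)}.
  have cB : continuous (fun v : 'rV[R]_n => v - z).
    move=> v; have cid : {for v, continuous (@id 'rV[R]_n)} by exact: cvg_id.
    exact: (continuousB cid (@cst_continuous _ _ z v)).
  exact: (within_continuous_comp cc cB).
have cdphi : {within `[a, b], continuous dphi}.
  apply: within_continuousM.
    by apply: (within_continuous_comp _ dtheta_cont); exact: within_continuous_edot.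
  apply: within_continuousM; first by move=> t; exact: cst_continuous.
  exact: within_continuous_edot.
have dphiE t : t \in `]a, b[ -> is_derive t (1 : R) (phi c) (dphi t).
  move=> tab; apply: (@is_derive1_comp _ theta (fun t => edot (c t - z) (c t - z))).
  by apply: is_derive_edot; exact: dc.
have theta_cont : continuous theta.
  by move=> s; apply: differentiable_continuous; apply/derivable1_diffP; exact: ex_derive.
have cphi : {within `[a, b], continuous (phi c)}.
  by apply: (within_continuous_comp _ theta_cont); exact: within_continuous_edot.
rewrite EFinB.
have := continuous_FTC2 ab cdphi (F := phi c).
have /(continuous_within_itvP _ ab)[_ cphia cphib] := cphi.
move=> /(_ _ _)<-.
- apply: (@le_trans _ _ (\int[lebesgue_measure]_(t in `[a, b]) (E t)%:E)%E).
    apply: le_integral; first exact: measurable_itv.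
    + exact: (continuous_compact_integrable (@segment_compact _ a b) cdphi).
    + exact: (continuous_compact_integrable (@segment_compact _ a b) cE).
    move=> t _; rewrite lee_fin /dphi /E.
    rewrite (le_trans (ler_norm _))// normrM normrM.
    apply: le_trans (ler_wpM2r (enorm_ge0 _) (dtheta_le (c t))).
    rewrite -!mulrA ler_wpM2l// [`|2|]ger0_norm// ler_pM2l//.
    rewrite ler_norml edot_le andbT lerNl.
    by rewrite -mulN1r -edotZl scaleN1r (le_trans (edot_le _ _))// enormN.
  rewrite (integral_itv_bndoo _ _ mS).
  rewrite integral_itv_bndoo; last first.
    apply/measurable_EFinP; apply: subspace_continuous_measurable_fun => //.
    by apply: continuous_subspaceW cE; exact: subset_itv_oo_cc.
  rewrite le_eqVlt; apply/orP; left; apply/eqP; apply: eq_integral => t.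
  by rewrite inE => /= tab; rewrite speedE.
- by split => // t /dphiE[].
- by move=> t /dphiE[? <-]; rewrite derive1E.
Qed.

(** Measurability of the speed is carried along the induction because splitting the integral at a
    break point requires it. *)
Lemma partition_length_ge (s : seq R) (a b : R) c : itv_partition a b s ->
  (forall k, (k < size s)%N -> C1_on (nth 0 (a :: s) k) (nth 0 s k) c) ->
  ((phi c b - phi c a)%:E <= \int[lebesgue_measure]_(t in `[a, b]) speed c t)%E /\
  measurable_fun `[a, b] (speed c).
Proof.
elim: s a => [|x s IH] a.
  move=> /itv_partition_nil <- _; rewrite subrr set_itv1.
  split; last exact: measurable_fun_set1.
  by apply: integral_ge0 => t _; rewrite lee_fin sqrtr_ge0.
move=> xs Hs; have ax : a < x by have [/= /andP[]] := xs.
have xb : x <= b by apply: itv_partition_le; exact: itv_partition_cons xs.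
have [H1 m1] := C1_length_ge ax (Hs 0%N isT).
have [|H2 m2] := IH x (itv_partition_cons xs).
  by move=> k ks; exact: (Hs k.+1 ks).
have abE : `[a, b]%classic = `[a, x]%classic `|` `]x, b]%classic.
  by rewrite -itv_bndbnd_setU// bnd_simp// ltW.
have mab : measurable_fun `[a, b] (speed c).
  rewrite abE; apply/measurable_funU => //; split => //.
  by apply: measurable_funS m2 => //; exact: subset_itv_oc_cc.
split => //.
rewrite abE ge0_integral_setU//=.
- rewrite -(subrKA (phi c x)) addrC EFinD; apply: leeD => //.
  rewrite integral_itv_obnd_cbnd//.
  by apply: measurable_funS m2 => //; exact: subset_itv_oc_cc.
- by rewrite -abE.
- by move=> t _; rewrite lee_fin sqrtr_ge0.
- apply/disj_setPS => t [/=]; rewrite !in_itv/= => /andP[_ tx] /andP[xt _].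
  by move: (lt_le_trans xt tx); rewrite ltxx.
Qed.

Lemma distance_ge x y :
  ((theta (edot (y - z) (y - z)) - theta (edot (x - z) (x - z)))%:E <=
   riemannian_distance g x y)%E.
Proof.
apply: le_ereal_inf_tmp => _ [c [[s s01 Hs] <- <-] <-].
exact: (partition_length_ge s01 Hs).1.
Qed.

End distance_lower_bound.

(** * A step function of class C^1 *)

Section smooth_step.
Context {R : realType}.
Implicit Types s t : R.

Definition pos_sqr t : R := Num.max 0 t ^+ 2.

Lemma is_derive_pos_sqr t : is_derive t (1 : R) pos_sqr (2 * Num.max 0 t).
Proof.
have [t0|t0|t0] := ltrgtP t 0.
- rewrite mulr0; apply: (@near_eq_is_derive _ _ _ (cst 0)).
    near=> s; rewrite /pos_sqr max_l ?expr0n//=; apply: ltW.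
    by near: s; exact: lt_nbhsl.
- have d2 : is_derive t (1 : R) (id ^+ 2) (2 * t).
    have := is_derive_quad 1 0 0 t; rewrite mulr1 addr0.
    by under eq_fun do rewrite mul1r mul0r !addr0.
  apply: near_eq_is_derive d2; near=> s; rewrite /pos_sqr max_r//; apply: ltW.
  by near: s; exact: lt_nbhsr.
- rewrite t0 mulr0; apply/is_derive1_caratheodory.
  exists (fun s => Num.max 0 s); split; last by rewrite maxxx.
    move=> s; rewrite /pos_sqr maxxx expr0n /= !subr0.
    by have [s0|s0] := leP 0 s; rewrite ?mul0r ?expr0n// expr2.
  by apply: continuous_max; [exact: cst_continuous|exact: cvg_id].
Unshelve. all: by end_near. Qed.

(** On [0, 1] this is 1 - (1 - t^2)^2. Truncating both squares makes it constant outside that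
    interval while preserving the continuity of the derivative. *)
Definition step t : R := 1 - pos_sqr (1 - pos_sqr t).

Definition dstep t : R := 2 * Num.max 0 (1 - pos_sqr t) * (2 * Num.max 0 t).

Lemma is_derive_step t : is_derive t (1 : R) step (dstep t).
Proof.
have d1 : is_derive t (1 : R) (fun s => 1 - pos_sqr s) (0 - 2 * Num.max 0 t).
  exact: (is_deriveB (is_derive_cst (1 : R) t 1) (is_derive_pos_sqr t)).
have d2 := @is_derive1_comp _ pos_sqr _ t _ _ (is_derive_pos_sqr _) d1.
apply: (@trigger_derive _ _ _ _ _ (is_deriveB (is_derive_cst (1 : R) t 1) d2)).
by rewrite /dstep; ring.
Qed.

Lemma continuous_pos_part : continuous (fun t : R => Num.max 0 t).
Proof.
by move=> t; apply: continuous_max; [exact: cst_continuous|exact: cvg_id].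
Qed.

Lemma continuous_dstep : continuous dstep.
Proof.
have cq : continuous pos_sqr.
  move=> t; apply: differentiable_continuous; apply/derivable1_diffP.
  by apply: ex_derive; exact: is_derive_pos_sqr.
move=> t; have c1 := continuousB (@cst_continuous _ _ (1 : R) t) (@cq t).
have c2 := continuous_comp c1 (@continuous_pos_part _).
have c3 := continuousM (@cst_continuous _ _ (2 : R) t) c2.
have c4 := continuousM (@cst_continuous _ _ (2 : R) t) (@continuous_pos_part t).
exact: (continuousM c3 c4).
Qed.

Lemma step_le0 t : t <= 0 -> step t = 0.
Proof.
by move=> t0; rewrite /step /pos_sqr (max_l t0) expr0n subr0 max_r// expr1n subrr.
Qed.

Lemma step_ge1 t : 1 <= t -> step t = 1.
Proof.
move=> t1; rewrite /step /pos_sqr [Num.max 0 t]max_r ?(le_trans _ t1)//.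
by rewrite max_l ?expr0n ?subr0// subr_le0 expr_ge1// (le_trans _ t1).
Qed.

Lemma dstep_le0 t : t <= 0 -> dstep t = 0.
Proof. by move=> t0; rewrite /dstep (max_l t0) !mulr0. Qed.

Lemma dstep_ge1 t : 1 <= t -> dstep t = 0.
Proof.
move=> t1; rewrite /dstep /pos_sqr [Num.max 0 t]max_r ?(le_trans _ t1)//.
by rewrite max_l ?mulr0 ?mul0r// subr_le0 expr_ge1// (le_trans _ t1).
Qed.

Lemma dstep_norm t : `|dstep t| <= 4.
Proof.
have [t1|t1] := leP 1 t; first by rewrite dstep_ge1// normr0.
have m0 : 0 <= Num.max 0 t by rewrite le_max lexx.
have m1 : Num.max 0 t <= 1 by rewrite ge_max ler01 ltW.
have p0 : 0 <= pos_sqr t by rewrite sqr_ge0.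
have q0 : 0 <= Num.max 0 (1 - pos_sqr t) by rewrite le_max lexx.
have q1 : Num.max 0 (1 - pos_sqr t) <= 1 by rewrite ge_max ler01/= lerBlDr lerDl.
rewrite ger0_norm /dstep; last by rewrite !mulr_ge0.
rewrite (_ : 4 = 2 * 1 * (2 * 1)); last by ring.
by rewrite ler_pM ?mulr_ge0// ler_pM2l.
Qed.

Lemma is_derive_step_affine (p q t : R) :
  is_derive t (1 : R) (fun s => step ((s - p) / q)) (dstep ((t - p) / q) / q).
Proof.
have d1 : is_derive t (1 : R) (fun s => (s - p) / q) q^-1.
  have := is_derive_affine q^-1 (- (q^-1 * p)) t.
  by under eq_fun do rewrite -mulrBr mulrC.
exact: (@is_derive1_comp _ step (fun s => (s - p) / q) t _ _ (is_derive_step _) d1).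
Qed.

Lemma continuous_dstep_affine (p q : R) :
  continuous (fun s => dstep ((s - p) / q) / q).
Proof.
move=> t.
have cid : {for t, continuous (@id R)} by exact: cvg_id.
have c1 := continuousM (continuousB cid (@cst_continuous _ _ p t))
  (@cst_continuous _ _ q^-1 t).
have c2 := continuous_comp c1 (@continuous_dstep _).
exact: (continuousM c2 (@cst_continuous _ _ q^-1 t)).
Qed.

End smooth_step.

Lemma doubling_lt {R : realDomainType} (r : nat -> R) :
  (forall k, 0 < r k) -> (forall k, 2 * r k < r k.+1) ->
  forall j k, (j < k)%N -> 2 * r j < r k.
Proof.
move=> r0 r2 j; elim=> // k IH; rewrite ltnS leq_eqVlt => /predU1P[->//|/IH jk].
by move: jk (r2 k) (r0 k); lra.
Qed.

Section distance_bounds.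
Context {R : realType} {n : nat} {u : 'rV[R]_n -> R}.
Context (u_cont : continuous u) (u_pos : forall x, 0 < u x).
Implicit Types (x y z : 'rV[R]_n).

Local Notation g := (conformal_metric u).
Local Notation W := (conformal_factor u).

(** Applying the one-sided bound to - theta as well takes the place of the symmetry of the
    distance. *)
Lemma distance_ge_norm (theta dtheta : R -> R) z :
  (forall s, is_derive s (1 : R) theta (dtheta s)) -> continuous dtheta ->
  (forall x, `|dtheta (edot (x - z) (x - z))| * (2 * enorm (x - z)) <= W x) ->
  forall x y, (`|theta (edot (y - z) (y - z)) - theta (edot (x - z) (x - z))|%:E <=
    riemannian_distance g x y)%E.
Proof.
move=> dth cdth Hth x y.
have [h|h] := ger0P (theta (edot (y - z) (y - z)) - theta (edot (x - z) (x - z))).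
  exact: (distance_ge u_cont u_pos dth cdth Hth).
rewrite opprB -[X in (X - _)%:E]opprK [X in X%:E]addrC.
apply: (distance_ge u_cont u_pos (theta := fun s => - theta s)
  (dtheta := fun s => - dtheta s)) => [s|w].
- exact: (continuousN (@cdth s)).
- by rewrite normrN.
Qed.

(** Take k times a step in |x - z|^2 from 0 to e^2. Its gradient is at most k (4 / e^2) (2 e) = 8 k
    / e, which equals m for k = m e / 8. *)
Lemma ball_distance_ge (z : 'rV[R]_n) (e m : R) : 0 < e -> 0 < m ->
  (forall x, enorm (x - z) <= e -> m <= W x) ->
  forall y, e <= enorm (y - z) ->
  ((m * e / 8)%:E <= riemannian_distance g z y)%E /\
  ((m * e / 8)%:E <= riemannian_distance g y z)%E.
Proof.
move=> e0 m0 mW y yz.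
have [k kE] : exists k, k = m * e / 8 by exists (m * e / 8).
have k0 : 0 < k by rewrite kE divr_gt0// mulr_gt0.
rewrite -kE.
have e20 : 0 < e ^+ 2 by rewrite exprn_gt0.
pose theta s := k * step ((s - 0) / e ^+ 2).
pose dtheta s := k * (dstep ((s - 0) / e ^+ 2) / e ^+ 2).
have dth (s : R) : is_derive s (1 : R) theta (dtheta s).
  by apply: is_deriveZ; exact: is_derive_step_affine.
have cdth : continuous dtheta.
  move=> s; exact: (continuousM (@cst_continuous _ _ k s)
    (@continuous_dstep_affine _ 0 _ s)).
have Hth x : `|dtheta (edot (x - z) (x - z))| * (2 * enorm (x - z)) <= W x.
  rewrite /dtheta subr0 -enorm_sqr; have [xe|ex] := leP (enorm (x - z)) e; last first.
    rewrite dstep_ge1; last first.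
      by rewrite ler_pdivlMr// mul1r lerXn2r ?nnegrE ?enorm_ge0// ltW.
    by rewrite mul0r mulr0 normr0 mul0r ltW// conformal_factor_gt0.
  apply: le_trans (mW _ xe).
  rewrite normrM [`|_ / _|]normrM (gtr0_norm k0) (@gtr0_norm _ (e ^+ 2)^-1) ?invr_gt0//.
  apply: (@le_trans _ _ (k * (4 / e ^+ 2) * (2 * e))); last first.
    by rewrite kE le_eqVlt; apply/orP; left; apply/eqP; field; rewrite gt_eqF.
  apply: ler_pM; rewrite ?mulr_ge0 ?enorm_ge0 ?invr_ge0 ?(ltW k0) ?(ltW e20)//.
    by rewrite ler_pM2l// ler_pM2r ?invr_gt0// dstep_norm.
  by rewrite ler_pM2l.
have tz : theta (edot (z - z) (z - z)) = 0.
  by rewrite /theta subrr -(scale0r (0 : 'rV[R]_n)) edotZl mul0r subr0 mul0r step_le0 ?mulr0.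
have ty : theta (edot (y - z) (y - z)) = k.
  rewrite /theta step_ge1 ?mulr1// subr0 ler_pdivlMr// mul1r -enorm_sqr.
  by rewrite lerXn2r ?nnegrE ?(ltW e0) ?enorm_ge0.
split.
  by have := distance_ge_norm dth cdth Hth z y; rewrite tz ty subr0 gtr0_norm.
by have := distance_ge_norm dth cdth Hth y z; rewrite tz ty sub0r normrN gtr0_norm.
Qed.

(** Each annulus carries a step in |x|^2 from r_k^2 to 4 r_k^2, of height c. The annuli are
    disjoint, so at most one step has a nonzero gradient at a given point, at most c (4 / (3 r_k^2))
    (4 r_k); this is m / r_k for c = 3 m / 16. The heights add up between x and y. *)
Lemma annuli_distance_ge (r : nat -> R) (m : R) (M : nat) : 0 < m ->
  0 < r 0%N -> (forall k, 2 * r k < r k.+1) ->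
  (forall k x, r k <= enorm x -> enorm x <= 2 * r k -> m / r k <= W x) ->
  forall x y, enorm x <= r 0%N -> r M <= enorm y ->
  ((M%:R * (3 / 16 * m))%:E <= riemannian_distance g x y)%E.
Proof.
move=> m0 r00 r2 rW x y xr ry.
have r0 k : 0 < r k.
  by elim: k => // k IH; rewrite (lt_trans _ (r2 k))// mulr_gt0.
have r2lt j k (jk : (j < k)%N) : 2 * r j <= r k := ltW (doubling_lt r0 r2 jk).
have [c cE] : exists c, c = 3 / 16 * m by exists (3 / 16 * m).
have c0 : 0 < c by rewrite cE mulr_gt0.
rewrite -cE.
pose p k := r k ^+ 2.
have p0 k : 0 < p k by rewrite exprn_gt0.
pose F (k : nat) (s : R) := c * step ((s - p k) / (3 * p k)).
pose dF (k : nat) (s : R) := c * (dstep ((s - p k) / (3 * p k)) / (3 * p k)).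
pose theta : R -> R := \sum_(k < M) F k.
pose dtheta s := \sum_(k < M) dF k s.
have dth (s : R) : is_derive s (1 : R) theta (dtheta s).
  by apply: is_derive_sum => i; apply: is_deriveZ; exact: is_derive_step_affine.
have cdth : continuous dtheta.
  have -> : dtheta = \sum_(k < M) dF k by apply/funext => s; rewrite fct_sumE.
  move=> s; apply: (big_ind (fun f : R -> R => {for s, continuous f})).
  - exact: cst_continuous.
  - by move=> f h cf ch; exact: (continuousD cf ch).
  - move=> i _; exact: (continuousM (@cst_continuous _ _ c s)
      (@continuous_dstep_affine _ _ _ s)).
have dF0 k w : ~~ (r k < enorm w < 2 * r k) -> dF k (enorm w ^+ 2) = 0.
  rewrite negb_and -!leNgt => /orP[wr|wr]; rewrite /dF.
    rewrite dstep_le0 ?mul0r ?mulr0// pmulr_lle0 ?invr_gt0 ?mulr_gt0//.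
    by rewrite subr_le0 lerXn2r ?nnegrE ?enorm_ge0// ltW.
  rewrite dstep_ge1 ?mul0r ?mulr0// ler_pdivlMr ?mulr_gt0// mul1r lerBrDr.
  rewrite (_ : 3 * p k + p k = (2 * r k) ^+ 2); last by rewrite /p; ring.
  by rewrite lerXn2r ?nnegrE ?enorm_ge0// mulr_ge0// ltW.
have Hth w : `|dtheta (edot (w - 0) (w - 0))| * (2 * enorm (w - 0)) <= W w.
  rewrite subr0 -enorm_sqr.
  have [/existsP[k /andP[kw wk]]|] :=
      boolP [exists k : 'I_M, r k < enorm w < 2 * r k]; last first.
    rewrite negb_exists => /forallP H.
    rewrite /dtheta big1 => [|i _]; last exact: dF0.
    by rewrite normr0 mul0r ltW// conformal_factor_gt0.
  rewrite /dtheta (bigD1 k)//= big1 ?addr0 => [|j jk]; last first.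
    apply: dF0; apply/negP => /andP[jw wj].
    have : (j < k)%N || (k < j)%N by rewrite -neq_ltn.
    move=> /orP[/r2lt|/r2lt] h.
      by move: (lt_le_trans wj (le_trans h (ltW kw))); rewrite ltxx.
    by move: (lt_le_trans wk (le_trans h (ltW jw))); rewrite ltxx.
  apply: le_trans (rW _ _ (ltW kw) (ltW wk)).
  have p3 : 0 < 3 * p k by rewrite mulr_gt0.
  rewrite /dF normrM [`|_ / _|]normrM (gtr0_norm c0) (@gtr0_norm _ (3 * p k)^-1) ?invr_gt0//.
  apply: (@le_trans _ _ (c * (4 / (3 * p k)) * (2 * (2 * r k)))); last first.
    by rewrite cE /p le_eqVlt; apply/orP; left; apply/eqP; field; rewrite gt_eqF.
  apply: ler_pM; rewrite ?mulr_ge0 ?enorm_ge0 ?invr_ge0 ?(ltW c0) ?(ltW p3)//.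
    by rewrite ler_pM2l// ler_pM2r ?invr_gt0// dstep_norm.
  by rewrite ler_pM2l// ltW.
have tx : theta (edot (x - 0) (x - 0)) = 0.
  rewrite subr0 -enorm_sqr /theta fct_sumE big1// => k _; rewrite /F.
  rewrite step_le0 ?mulr0// pmulr_lle0 ?invr_gt0 ?mulr_gt0//.
  rewrite subr_le0 lerXn2r ?nnegrE ?enorm_ge0 ?(ltW (r0 _))// (le_trans xr)//.
  case: (val k) => // j; have := r2lt 0%N j.+1 isT; lra.
have ty : theta (edot (y - 0) (y - 0)) = M%:R * c.
  rewrite subr0 -enorm_sqr /theta fct_sumE.
  rewrite (eq_bigr (fun=> c)) ?sumr_const ?card_ord ?mulr_natl// => k _.
  rewrite /F step_ge1 ?mulr1// ler_pdivlMr ?mulr_gt0// mul1r lerBrDr.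
  rewrite (_ : 3 * p k + p k = (2 * r k) ^+ 2); last by rewrite /p; ring.
  rewrite lerXn2r ?nnegrE ?enorm_ge0// ?mulr_ge0 ?(ltW (r0 _))//.
  by rewrite (le_trans _ ry)// r2lt.
have := distance_ge_norm dth cdth Hth x y.
by rewrite tx ty subr0 ger0_norm// mulr_ge0// ltW.
Qed.

End distance_bounds.

(** * Completeness and incompleteness *)

Section completeness.
Context {R : realType} {n : nat} {u : 'rV[R]_n -> R}.
Context (u_cont : continuous u) (u_pos : forall x, 0 < u x).
Implicit Types (x y z : 'rV[R]_n).

Local Notation g := (conformal_metric u).
Local Notation W := (conformal_factor u).

Lemma curve_distance_le (c : R -> 'rV[R]_n) (C : R) :
  0 <= C -> C1_on 0 1 c ->
  (forall t, 0 <= t -> t <= 1 -> W (c t) * enorm (derive1 c t) <= C) ->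
  (riemannian_distance g (c 0%R) (c 1%R) <= C%:E)%E.
Proof.
move=> C0 cC1 HC; apply: (@le_trans _ _ (curve_length g c)).
  apply: ereal_inf_lbound; exists c => //; split => //.
  exists [:: 1]; first exact: itv_partition1.
  by case.
rewrite /curve_length.
apply: (@le_trans _ _ (\int[lebesgue_measure]_(t in `[0%R, 1%R]) C%:E)%E).
  apply: ge0_le_integral_nonmeasurable => t; first by rewrite lee_fin sqrtr_ge0.
  rewrite /= in_itv/= => /andP[t0 t1].
  by rewrite lee_fin sqrt_conformal_metric HC.
rewrite integral_cst//= lebesgue_measure_itv/= lte_fin ltr01 oppr0 adde0.
by rewrite mule1.
Qed.

Lemma segment_distance_le x y (C : R) :
  (forall t, 0 <= t -> t <= 1 -> W (x + t *: (y - x)) <= C) ->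
  (riemannian_distance g x y <= (C * enorm (y - x))%:E)%E.
Proof.
move=> HC; pose c (t : R) := x + t *: (y - x).
have C0 : 0 <= C.
  by rewrite (le_trans _ (HC 0 _ _))// ltW// conformal_factor_gt0.
have dc (t : R) : is_derive t (1 : R) c (y - x).
  have did : is_derive t (1 : R) (fun s : R => s *: (y - x)) (y - x).
    by rewrite -[X in is_derive _ _ _ X]scale1r; exact: is_derive_scalel.
  have := is_deriveD (is_derive_cst x t 1) did; rewrite add0r; exact.
have cc : continuous c by exact: continuous_line.
have c01 : C1_on 0 1 c.
  split; first exact: continuous_subspaceT.
  exists (cst (y - x)); split => //.
  by apply: continuous_subspaceT => t; exact: cst_continuous.
have := @curve_distance_le c (C * enorm (y - x)) _ c01.
rewrite /c scale0r addr0 scale1r [x + (y - x)]addrC subrK; apply.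
  by rewrite mulr_ge0// enorm_ge0.
move=> t t0 t1; rewrite derive1E; have [_ ->] := dc t.
by rewrite ler_wpM2r ?enorm_ge0// HC.
Qed.

Lemma conformal_factor_bounds (T : R) : 0 <= T -> exists m M : R, [/\ 0 < m, 0 < M &
  forall x, enorm x <= T -> m <= W x /\ W x <= M].
Proof.
move=> T0; pose D := [set x : 'rV[R]_n | enorm x <= T].
have D0 : D !=set0.
  by exists 0; rewrite /D /= /enorm -(scale0r (0 : 'rV[R]_n)) edotZl mul0r sqrtr0.
have cD : compact D.
  apply: (@enorm_bounded_closed_compact _ _ _ 0 T).
    by apply: closed_fun_le; exact: continuous_enorm0.
  by move=> x; rewrite subr0.
have cW : {within D, continuous W}.
  by apply: continuous_subspaceT; exact: continuous_conformal_factor.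
have [p _ Hp] := EVT_min_rV D0 cD cW.
have [q _ Hq] := EVT_max_rV D0 cD cW.
exists (W p), (W q); split; [exact: conformal_factor_gt0|exact: conformal_factor_gt0|].
by move=> x /mem_set xT; split; [exact: Hp|exact: Hq].
Qed.

Lemma enorm_segment x y (t T : R) : 0 <= t -> t <= 1 -> enorm x <= T ->
  enorm y <= T -> enorm (x + t *: (y - x)) <= T.
Proof.
move=> t0 t1 xT yT; have -> : x + t *: (y - x) = (1 - t) *: x + t *: y.
  by rewrite scalerBr scalerBl scale1r addrAC addrA.
rewrite (le_trans (enormD _ _))// !enormZ !ger0_norm ?subr_ge0//.
have h1 : (1 - t) * enorm x <= (1 - t) * T by rewrite ler_wpM2l// subr_ge0.
have h2 : t * enorm y <= t * T by rewrite ler_wpM2l.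
lra.
Qed.

Lemma fat_annuli_sequence (m rho : R) :
  (forall rho, exists2 r, rho <= r & 0 < r /\
    forall x, r <= enorm x -> enorm x <= 2 * r -> m / r <= W x) ->
  exists r : nat -> R, [/\ rho <= r 0%N, forall k, 0 < r k,
    forall k, 2 * r k < r k.+1 &
    forall k x, r k <= enorm x -> enorm x <= 2 * r k -> m / r k <= W x].
Proof.
move=> Hr; pose f (s : R) : R := sval (cid2 (Hr s)).
have fP s : s <= f s /\ (0 < f s /\
    forall x, f s <= enorm x -> enorm x <= 2 * f s -> m / f s <= W x).
  by rewrite /f; case: cid2.
(* The summand 1 makes the doubling strict. *)
pose r k := iter k (fun s => f (2 * s + 1)) (f rho).
have rf k : exists s, r k = f s.
  by case: k => [|k]; [exists rho|exists (2 * r k + 1)].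
exists r; split.
- exact: (fP rho).1.
- by move=> k; have [s ->] := rf k; exact: (fP s).2.1.
- move=> k; apply: (@lt_le_trans _ _ (2 * r k + 1)); first by rewrite ltrDl.
  exact: (fP _).1.
- by move=> k x; have [s ->] := rf k; exact: (fP s).2.2.
Qed.

(** Crossing enough annuli costs more than the Cauchy tolerance, so a Cauchy sequence is bounded. On
    a ball W lies between positive constants, which makes the sequence Euclidean Cauchy; straight
    segments show that its Euclidean limit is the limit for the distance. *)
Lemma complete_of_fat_annuli (m : R) : 0 < m ->
  (forall rho, exists2 r, rho <= r & 0 < r /\
    forall x, r <= enorm x -> enorm x <= 2 * r -> m / r <= W x) ->
  complete_metric g.
Proof.
move=> m0 Hr x cx.
have [T [N0 [T0 xT]]] : exists T N0, 0 < T /\ forall k, (N0 <= k)%N -> enorm (x k) <= T.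
  have [N0 HN0] := cx 1 ltr01.
  have [r [r_ge r0 r2 rW]] := fat_annuli_sequence (enorm (x N0)) Hr.
  pose c := 3 / 16 * m.
  have c0 : 0 < c by rewrite mulr_gt0.
  pose M := (Num.truncn c^-1).+1.
  have Mc : 1 <= M%:R * c.
    by rewrite -ler_pdivrMr// mul1r ltW// truncnS_gt.
  exists (r M), N0; split => // k Nk; rewrite leNgt; apply/negP => /ltW rk.
  have := annuli_distance_ge u_cont u_pos m0 (r0 0%N) r2 rW r_ge rk.
  rewrite leNgt => /negP; apply.
  by apply: lt_le_trans (HN0 _ _ (leqnn _) Nk) _; rewrite lee_fin.
have [m1 [M1 [m10 M10 HW]]] := conformal_factor_bounds (addr_ge0 (ltW T0) ler01).
have ecauchy (e : R) : 0 < e -> exists N1, forall j k, (N1 <= j)%N -> (N1 <= k)%N ->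
    enorm (x k - x j) < e.
  (* A radius at most 1 keeps the balls about the [x j] inside the ball of radius T + 1, where W is
     bounded below. *)
  move=> e0; pose e1 := Num.min e 1.
  have e10 : 0 < e1 by rewrite lt_min e0 ltr01.
  have ee : 0 < m1 * e1 / 8 by rewrite divr_gt0// mulr_gt0.
  have [N1 HN1] := cx _ ee.
  exists (maxn N0 N1) => j k; rewrite !geq_max => /andP[Nj N1j] /andP[Nk N1k].
  have [//|ek] := ltP (enorm (x k - x j)) e.
  have := HN1 j k N1j N1k; rewrite ltNge => /negP; case.
  apply: (ball_distance_ge u_cont u_pos e10 m10 _ _).1.
    move=> y yj; apply: (HW y _).1.
    have := enormD (y - x j) (x j); rewrite subrK => /le_trans; apply.
    rewrite addrC lerD ?xT// (le_trans yj)//.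
    by rewrite ge_min lexx orbT.
  by rewrite (le_trans _ ek)// ge_min lexx.
have /cauchy_cvgP/cvg_ex[l xl] : cauchy (x @ \oo).
  apply: cauchy_exP => e e0; have [N1 HN1] := ecauchy _ e0.
  exists (x N1); exists N1 => // k /= Nk; rewrite -ball_normE /= distrC.
  by apply: le_lt_trans (mx_norm_le_enorm _) _; exact: HN1.
have xle (e : R) : 0 < e -> exists N1, forall k, (N1 <= k)%N -> enorm (l - x k) <= e.
  move=> e0; have en : 0 < e / (n%:R + 1) by rewrite divr_gt0// ltr_wpDl.
  move/cvgrPdist_lt : xl => /(_ _ en)[N1 _ HN1].
  exists N1 => k Nk.
  have := HN1 k Nk => /= lx.
  apply: (@le_trans _ _ (n%:R * (e / (n%:R + 1)))).
    apply: enorm_le_coord; first exact: ltW.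
    move=> i; apply: le_trans (ltW lx).
    rewrite [leRHS]/Num.Def.normr/= mx_normrE.
    by apply: le_trans; last exact: (le_bigmax _ _ (ord0, i)).
  rewrite mulrCA ler_piMr ?(ltW e0)// ler_pdivrMr ?ltr_wpDl// mul1r.
  by rewrite lerDl.
exists l => e e0.
have [N1 HN1] := xle 1 ltr01.
have lT : enorm l <= T + 1.
  pose k := maxn N0 N1.
  have := enormD (l - x k) (x k); rewrite subrK => /le_trans; apply.
  by rewrite addrC lerD// ?xT ?HN1// /k leq_max leqnn ?orbT.
have eM : 0 < e / (2 * M1) by rewrite divr_gt0// mulr_gt0.
have [N2 HN2] := xle _ eM.
exists (maxn N0 N2) => k; rewrite geq_max => /andP[Nk N2k].
apply: (@le_lt_trans _ _ (M1 * enorm (l - x k))%:E).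
  apply: segment_distance_le => t t0 t1; apply: (HW _ _).2.
  by apply: enorm_segment => //; rewrite (le_trans (xT _ Nk))// lerDl.
rewrite lte_fin; apply: (@le_lt_trans _ _ (M1 * (e / (2 * M1)))).
  by rewrite ler_pM2l// HN2.
have -> : M1 * (e / (2 * M1)) = e / 2 by field; rewrite gt_eqF.
by rewrite ltr_pdivrMr// ltr_pMr// ltr1n.
Qed.

End completeness.

Section incompleteness.
Context {R : realType} {n : nat} {u : 'rV[R]_n -> R}.
Context (u_cont : continuous u) (u_pos : forall x, 0 < u x).

Local Notation g := (conformal_metric u).
Local Notation W := (conformal_factor u).

(* The point at distance rho from the origin is reached through the inverted
   parameter 1/rho, for which the speed is bounded when W <= C / |x|^2. *)
Lemma ray_distance_le (v : 'rV[R]_n) (C r al be : R) :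
  enorm v = 1 -> 0 < C -> 0 < r ->
  (forall x, r <= enorm x -> W x <= C / enorm x ^+ 2) ->
  0 < al -> 0 < be -> al <= r^-1 -> be <= r^-1 ->
  (riemannian_distance g (al^-1 *: v) (be^-1 *: v) <= (C * `|be - al|)%:E)%E.
Proof.
move=> v1 C0 r0 HW al0 be0 alr ber.
pose s (t : R) : R := al + t * (be - al).
pose c (t : R) := (s t)^-1 *: v.
have sP t : 0 <= t -> t <= 1 -> 0 < s t /\ s t <= r^-1.
  move=> t0 t1; have -> : s t = (1 - t) * al + t * be by rewrite /s; ring.
  have t1' : 0 <= 1 - t by rewrite subr_ge0.
  have h1 : (1 - t) * al <= (1 - t) * r^-1 by rewrite ler_wpM2l.
  have h2 : t * be <= t * r^-1 by rewrite ler_wpM2l.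
  split; last by lra.
  have [t00|tn0] := eqVneq t 0; first by rewrite t00 subr0 mul1r mul0r addr0.
  apply: ltr_wpDl; first by rewrite mulr_ge0// ltW.
  by rewrite mulr_gt0// lt0r tn0.
have ds (t : R) : is_derive t (1 : R) s (be - al).
  have := is_derive_affine (be - al) al t.
  by under eq_fun do rewrite addrC mulrC.
have cs : continuous s.
  by move=> t; apply: differentiable_continuous; apply/derivable1_diffP; exact: ex_derive.
pose d (t : R) := (- (s t) ^- 2 * (be - al)) *: v.
have dc (t : R) : 0 <= t -> t <= 1 -> is_derive t (1 : R) c (d t).
  move=> t0 t1; apply: is_derive_scalel; apply: is_deriveV => //.
  by rewrite gt_eqF//; exact: (sP _ t0 t1).1.
have cV (t : R) : 0 <= t -> t <= 1 -> {for t, continuous (fun w => (s w)^-1)}.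
  move=> t0 t1; apply: continuousV; last exact: cs.
  by rewrite gt_eqF//; exact: (sP _ t0 t1).1.
have c01 : C1_on 0 1 c.
  split.
    apply: continuous_in_subspaceT => t; rewrite inE /= in_itv/= => /andP[t0 t1].
    exact: (continuous_comp (cV _ t0 t1) (@scalel_continuous _ _ v _)).
  exists d; split; last first.
    by move=> t; rewrite in_itv/= => /andP[t0 t1]; apply: dc; exact: ltW.
  apply: continuous_in_subspaceT => t; rewrite inE /= in_itv/= => /andP[t0 t1].
  have -> : d = (fun w => (- ((s w)^-1 * (s w)^-1) * (be - al)) *: v).
    by apply/funext => w; rewrite /d -expr2 exprVn.
  have c1 := continuousN (continuousM (cV _ t0 t1) (cV _ t0 t1)).
  have c2 := continuousM c1 (@cst_continuous _ _ (be - al) t).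
  exact: (continuous_comp c2 (@scalel_continuous _ _ v _)).
have C0' : 0 <= C * `|be - al| by rewrite mulr_ge0// ltW.
have := curve_distance_le C0' c01.
have -> : c 0 = al^-1 *: v by rewrite /c /s mul0r addr0.
have -> : c 1 = be^-1 *: v by rewrite /c /s mul1r addrC subrK.
apply => t t0 t1.
have [st0 str] := sP _ t0 t1.
rewrite derive1E; have [_ ->] := dc _ t0 t1.
have ct : enorm (c t) = (s t)^-1.
  by rewrite /c enormZ v1 mulr1 gtr0_norm// invr_gt0.
have sn : s t != 0 by rewrite gt_eqF.
rewrite /d enormZ v1 mulr1 normrM normrN (@gtr0_norm _ (s t ^- 2)) ?invr_gt0 ?exprn_gt0//.
apply: (@le_trans _ _ (C / (s t)^-1 ^+ 2 * ((s t) ^- 2 * `|be - al|))).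
  apply: ler_wpM2r; first by rewrite mulr_ge0// invr_ge0 exprn_ge0// ltW.
  rewrite -ct; apply: HW; rewrite ct -[r]invrK lef_pV2// posrE//.
  by rewrite invr_gt0.
by rewrite le_eqVlt; apply/orP; left; apply/eqP; field.
Qed.

(** The points at distance r (k + 1) on a ray form a Cauchy sequence. They leave every Euclidean
    ball, whereas a limit l would keep all points outside its unit ball at distance at least m /
    8. *)
Lemma incomplete_of_decay (C r : R) : (0 < n)%N -> 0 < C -> 0 < r ->
  (forall x, r <= enorm x -> W x <= C / enorm x ^+ 2) -> ~ complete_metric g.
Proof.
move=> n0 C0 r0 HW cg.
pose v : 'rV[R]_n := delta_mx 0 (Ordinal n0).
have v1 : enorm v = 1 by exact: enorm_delta.
pose al (k : nat) : R := (r * k.+1%:R)^-1.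
have al0 k : 0 < al k by rewrite invr_gt0 mulr_gt0.
have alr k : al k <= r^-1.
  rewrite lef_pV2 ?posrE ?mulr_gt0//.
  by rewrite ler_peMr ?(ltW r0)// ler1n.
have al_le j k : (j <= k)%N -> al k <= al j.
  by move=> jk; rewrite lef_pV2 ?posrE ?mulr_gt0// ler_pM2l// ler_nat ltnS.
pose x k := (al k)^-1 *: v.
have [|l Hl] := cg x.
  move=> e e0; pose M := Num.truncn (C / (r * e)).
  exists M => j k Mj Mk.
  apply: (le_lt_trans (ray_distance_le v1 C0 r0 HW (al0 j) (al0 k) (alr j) (alr k))).
  rewrite lte_fin; apply: (@le_lt_trans _ _ (C * al M)).
    rewrite ler_pM2l// ler_norml.
    have := al_le _ _ Mj; have := al_le _ _ Mk; have := al0 j; have := al0 k.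
    by move=> *; apply/andP; split; lra.
  rewrite /al ltr_pdivrMr ?mulr_gt0// mulrA [ltRHS]mulrC.
  by rewrite -ltr_pdivrMr ?mulr_gt0// [e * r]mulrC truncnS_gt.
have [m [M [m0 M0 HM]]] := conformal_factor_bounds u_cont u_pos
  (addr_ge0 (enorm_ge0 l) ler01).
have m8 : 0 < m * 1 / 8 by rewrite divr_gt0// mulr_gt0.
have [N1 HN1] := Hl _ m8.
pose k := maxn N1 (Num.truncn ((enorm l + 1) / r)).
have := HN1 k (leq_maxl _ _); rewrite ltNge => /negP; apply.
apply: (ball_distance_ge u_cont u_pos ltr01 m0 _ _).2.
  move=> y yl; apply: (HM y _).1.
  have := enormD (y - l) l; rewrite subrK => /le_trans; apply.
  by rewrite addrC lerD2l.
have xk : enorm l + 1 <= enorm (x k).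
  have -> : enorm (x k) = r * k.+1%:R.
    by rewrite /x enormZ v1 mulr1 /al invrK gtr0_norm// mulr_gt0.
  rewrite mulrC -ler_pdivrMr//; apply: (le_trans (ltW (truncnS_gt _))).
  by rewrite ler_nat ltnS leq_maxr.
have := enormD (x k - l) l; rewrite subrK; lra.
Qed.

End incompleteness.

(** * Volume *)

Section volume.
Context {R : realType} {n : nat} {u : 'rV[R]_n -> R}.
Context (u_cont : continuous u) (u_pos : forall x, 0 < u x).

Local Notation W := (conformal_factor u).
Local Notation mu := (@lebesgue_measure_tuple R n).
Local Notation RT := (measurableTypeR R).

Definition vec_of_tuple (t : n.-tuple RT) : 'rV[R]_n := \row_i tnth t i.

Definition box (z : 'rV[R]_n) (h : R) : set (n.-tuple RT) :=
  [set t | forall i, tnth t i \in `[z 0 i - h, z 0 i + h]].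

Lemma measurable_box z h : measurable (box z h).
Proof.
rewrite (_ : box z h = \bigcap_(i in [set: 'I_n])
    ((fun t : n.-tuple RT => tnth t i) @^-1` `[z 0 i - h, z 0 i + h])).
  apply: fin_bigcap_measurable => // i _.
  by rewrite -[X in measurable X]setTI; exact: measurable_tnth.
by apply/seteqP; split => t /= Ht i; [move=> _; exact: Ht|exact: Ht].
Qed.

Lemma measure_box z h : 0 < h -> mu (box z h) = ((2 * h) ^+ n)%:E.
Proof.
move=> h0.
rewrite (lebesgue_measure_tuple_box (A := fun i => `[z 0 i - h, z 0 i + h]%classic))//.
rewrite (eq_bigr (fun=> (2 * h)%:E)) => [|i _]; last first.
  have hh : z 0 i - h < z 0 i + h by lra.
  by rewrite lebesgue_measure_itv/= lte_fin hh -EFinB; congr EFin; ring.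
rewrite -(big_mkord xpredT (fun=> (2 * h)%:E)).
by rewrite prodEFin big_const_nat subn0 iter_mulr_1.
Qed.

Lemma boxP (z : 'rV[R]_n) h t : box z h t -> forall i, `|vec_of_tuple t 0 i - z 0 i| <= h.
Proof.
move=> tz i; have := tz i; rewrite mxE in_itv/= => /andP[h1 h2].
by rewrite ler_norml; apply/andP; split; lra.
Qed.

Lemma box_mem (z : 'rV[R]_n) h t : (forall i, `|vec_of_tuple t 0 i - z 0 i| <= h) ->
  box z h t.
Proof.
move=> tz i; have := tz i; rewrite mxE in_itv/= ler_norml => /andP[h1 h2].
by apply/andP; split; lra.
Qed.

Lemma conformal_volume_density x : n%:R - 2 != 0 :> R ->
  u x `^ (2 * n%:R / (n%:R - 2)) = W x ^+ n.
Proof.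
by move=> n2; rewrite -powR_mulrn ?powR_ge0// -powRrM; congr powR; field.
Qed.

Let measurable_scaled_indic (c : R) A : measurable A ->
  measurable_fun setT (fun t : n.-tuple RT => (c%:E * (\1_A t)%:E)%E).
Proof.
move=> mA; apply: measurable_funeM; apply/measurable_EFinP.
exact: measurable_indic.
Qed.

Let integral_scaled_indic (c : R) A : 0 <= c -> measurable A ->
  (\int[mu]_t (c%:E * (\1_A t)%:E) = c%:E * mu A)%E.
Proof.
move=> c0 mA; rewrite ge0_integralZl_EFin//; first by rewrite integral_indic// setIT.
by apply/measurable_EFinP; exact: measurable_indic.
Qed.

(** A cube of half-side r / (2 n) centred at distance 3 r / 2 from the origin fits into the annulus.
    Its volume (r / n)^n times the density (m / r)^n is (m / n)^n for every r, and the cubes are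
    disjoint. *)
Lemma volume_infinite_of_fat_annuli (m : R) : (0 < n)%N -> n%:R - 2 != 0 :> R ->
  0 < m ->
  (forall rho, exists2 r, rho <= r & 0 < r /\
    forall x, r <= enorm x -> enorm x <= 2 * r -> m / r <= W x) ->
  total_volume u = +oo%E.
Proof.
move=> n0 n2 m0 Hr.
have [r [_ r0 r2 rW]] := fat_annuli_sequence 0 Hr.
have r2lt := doubling_lt r0 r2.
have nR : 0 < n%:R :> R by rewrite ltr0n.
pose z k : 'rV[R]_n := (3 / 2 * r k) *: delta_mx 0 (Ordinal n0).
pose h k := r k / (2 * n%:R).
have h0 k : 0 < h k by rewrite divr_gt0// mulr_gt0.
pose B k := box (z k) (h k).
have BP k t : B k t -> r k <= enorm (vec_of_tuple t) /\ enorm (vec_of_tuple t) <= 2 * r k.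
  move=> /boxP Bt.
  have zk : enorm (z k) = 3 / 2 * r k.
    by rewrite enormZ enorm_delta mulr1 gtr0_norm// mulr_gt0.
  have : enorm (vec_of_tuple t - z k) <= n%:R * h k.
    by apply: enorm_le_coord; [exact: ltW|move=> i; rewrite mxE [(- z k) 0 i]mxE; exact: Bt].
  have -> : n%:R * h k = r k / 2 by rewrite /h; field; rewrite gt_eqF.
  have := enormD (vec_of_tuple t - z k) (z k); rewrite subrK zk.
  have := enormD (z k - vec_of_tuple t) (vec_of_tuple t).
  by rewrite subrK zk enormB; lra.
pose c k := (m / r k) ^+ n.
have c0 k : 0 <= c k by rewrite exprn_ge0// divr_ge0// ltW.
pose kap := (m / n%:R) ^+ n.
have kap0 : 0 < kap by rewrite exprn_gt0// divr_gt0.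
have cB k : ((c k)%:E * mu (B k) = kap%:E)%E.
  rewrite measure_box// -EFinM -exprMn /kap; congr (_ ^+ _)%:E.
  by rewrite /h; field; rewrite !gt_eqF.
suff H (M : nat) : ((M%:R * kap)%:E <= total_volume u)%E.
  apply/eqyP => A A0; apply: le_trans (H (Num.truncn (A / kap)).+1).
  by rewrite lee_fin -ler_pdivrMr// ltW// truncnS_gt.
pose f k (t : n.-tuple RT) := ((c k)%:E * (\1_(B k) t)%:E)%E.
have f0 k t : (0 <= f k t)%E by rewrite mule_ge0// lee_fin.
apply: (@le_trans _ _ (\int[mu]_t (\sum_(k <- index_iota 0 M) f k t))%E).
  rewrite ge0_integral_sum//; last first.
    by move=> k; apply: measurable_scaled_indic; exact: measurable_box.
  rewrite (eq_bigr (fun=> kap%:E)) => [|k _]; last first.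
    by rewrite integral_scaled_indic ?cB//; exact: measurable_box.
  by rewrite sumEFin big_const_nat subn0 iter_addr_0 mulr_natl.
apply: ge0_le_integral_nonmeasurable => t _; first exact: sume_ge0.
rewrite conformal_volume_density// -/(vec_of_tuple t).
have W0 : 0 <= W (vec_of_tuple t) ^+ n by rewrite exprn_ge0// ltW// conformal_factor_gt0.
have [[k Bk]|nB] := pselect (exists k, B k t); last first.
  rewrite big1 ?lee_fin// => k _; rewrite /f indicE memNset ?mule0//.
  by move=> Bk; apply: nB; exists k.
have fj j : j != k -> f j t = 0%E.
  move=> jk; rewrite /f indicE memNset ?mule0// => Bj.
  have [j1 j2] := BP _ _ Bj; have [k1 k2] := BP _ _ Bk.
  by move: jk; rewrite neq_ltn => /orP[/r2lt|/r2lt]; lra.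
have fk : (f k t <= (W (vec_of_tuple t) ^+ n)%:E)%E.
  rewrite /f indicE mem_set// mule1 lee_fin lerXn2r ?nnegrE//.
  - by rewrite divr_ge0// ltW.
  - by rewrite ltW// conformal_factor_gt0.
  - by have [b1 b2] := BP _ _ Bk; exact: rW b1 b2.
have [kM|kM] := ltnP k M.
  rewrite (bigD1_seq k) ?mem_index_iota ?iota_uniq//=.
  by rewrite big1 ?adde0// => j; exact: fj.
rewrite big_nat_cond big1 ?lee_fin// => j /andP[/andP[_ jM] _].
by apply: fj; rewrite neq_ltn (leq_trans jM kM).
Qed.

(** Let k be least such that x lies in the cube of half-side 2^k r. For k > 0 some coordinate
    exceeds 2^(k-1) r in absolute value, so W <= A / 4^k. The density is thus dominated by a sum
    over cubes whose k-th term has integral (2 A r / 2^k)^n. *)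
Lemma volume_finite_of_decay (C r : R) : (0 < n)%N -> n%:R - 2 != 0 :> R ->
  0 < C -> 0 < r ->
  (forall x, r <= enorm x -> W x <= C / enorm x ^+ 2) ->
  (total_volume u < +oo)%E.
Proof.
move=> n0 n2 C0 r0 HW.
have [m [M0 [m0 M00 HM]]] := conformal_factor_bounds u_cont u_pos
  (mulr_ge0 (ler0n R n) (ltW r0)).
(* The first entry serves the smallest cube, where |x| <= n r; the second absorbs the shift from k
   to k + 1 in the decay bound. *)
pose A := Num.max M0 (C * (2 / r) ^+ 2).
have A0 : 0 < A by rewrite lt_max M00.
pose h k := 2 ^+ k * r.
have h0 k : 0 < h k by rewrite mulr_gt0// exprn_gt0.
pose B k := box 0 (h k).
have hS k : h k.+1 = 2 * h k by rewrite /h exprS mulrA.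
pose c k := (A / (2 ^+ k) ^+ 2) ^+ n.
have c0 k : 0 <= c k by rewrite exprn_ge0// divr_ge0 ?(ltW A0)// exprn_ge0// exprn_ge0.
pose f k (t : n.-tuple RT) := ((c k)%:E * (\1_(B k) t)%:E)%E.
have f0 k t : (0 <= f k t)%E by rewrite mule_ge0// lee_fin.
have W_le (t : n.-tuple RT) : exists2 k, B k t & W (vec_of_tuple t) ^+ n <= c k.
  set x := vec_of_tuple t.
  have exk : exists k, [forall i, `|x 0 i| <= h k].
    exists (Num.truncn (enorm x / r)).+1; apply/forallP => i.
    rewrite (le_trans (coord_le_enorm _ _))// /h -ler_pdivrMr//.
    apply: (le_trans (ltW (truncnS_gt _))).
    by rewrite -natrX ler_nat ltnW// ltn_expl.
  case: (ex_minnP exk) => k /forallP xk kmin.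
  exists k.
    by apply: box_mem => i; rewrite [(0 : 'rV_n) 0 i]mxE subr0 xk.
  have Wx0 : 0 <= W x by rewrite ltW// conformal_factor_gt0.
  rewrite lerXn2r ?nnegrE ?divr_ge0 ?(ltW A0) ?exprn_ge0//.
  case: k xk kmin => [|k] xk kmin.
    rewrite expr0 expr1n divr1 (le_trans (HM _ _).2) ?le_max ?lexx//.
    by apply: enorm_le_coord; [exact: ltW|move=> i; have := xk i; rewrite /h expr0 mul1r].
  have [i xi] : exists i, h k < `|x 0 i|.
    have : ~~ [forall i, `|x 0 i| <= h k].
      by apply/negP => /kmin; rewrite ltnn.
    by rewrite negb_forall => /existsP[i]; rewrite -ltNge => xi; exists i.
  have xh : h k <= enorm x by rewrite (le_trans (ltW xi))// coord_le_enorm.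
  have hr : r <= h k by rewrite /h ler_peMl ?(ltW r0)// exprn_ege1// ler1n.
  apply: (le_trans (HW _ (le_trans hr xh))).
  apply: (@le_trans _ _ (C / h k ^+ 2)).
    rewrite ler_pM2l// lef_pV2 ?posrE ?exprn_gt0//; last exact: lt_le_trans xh.
    by rewrite lerXn2r ?nnegrE ?enorm_ge0 ?(ltW (h0 _)).
  have -> : C / h k ^+ 2 = C * (2 / r) ^+ 2 / (2 ^+ k.+1) ^+ 2.
    rewrite /h [2 ^+ k.+1]exprS; have : 2 ^+ k != 0 :> R by rewrite expf_neq0.
    by move: (2 ^+ k) => p p0; field; rewrite p0 gt_eqF.
  by rewrite ler_pM2r ?invr_gt0 ?exprn_gt0// le_max lexx orbT.
apply: (@le_lt_trans _ _ (\int[mu]_t (\sum_(k <oo) f k t))%E).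
  apply: ge0_le_integral_nonmeasurable => t _.
    by rewrite lee_fin powR_ge0.
  rewrite conformal_volume_density// -/(vec_of_tuple t).
  have [k Bk Wk] := W_le t.
  apply: (@le_trans _ _ (f k t)).
    by rewrite /f indicE mem_set// mule1 lee_fin.
  apply: le_trans (nneseries_lim_ge k.+1 _); last by move=> *; exact: f0.
  by rewrite big_nat_recr//= leeDr// sume_ge0.
rewrite integral_nneseries//; last first.
  by move=> k; apply: measurable_scaled_indic; exact: measurable_box.
pose Q := (A * (2 * r)) ^+ n.
have Q0 : 0 <= Q by rewrite exprn_ge0// !mulr_ge0// ltW.
apply: (@le_lt_trans _ _ (Q * 2)%:E); last exact: ltry.
apply: lime_le.
  by apply: is_cvg_nneseries => k _ _; apply: integral_ge0.
apply: nearW => p.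
apply: (@le_trans _ _ (\sum_(0 <= k < p) (Q * (2^-1) ^+ k)%:E)%E).
  apply: lee_sum => k _.
  rewrite integral_scaled_indic//; last exact: measurable_box.
  rewrite measure_box// -EFinM lee_fin /c -exprMn.
  have -> : A / (2 ^+ k) ^+ 2 * (2 * h k) = (A * (2 * r)) * (2^-1) ^+ k.
    rewrite /h exprVn; have : 2 ^+ k != 0 :> R by rewrite expf_neq0.
    by move: (2 ^+ k) => p' p0; field.
  (* Since n >= 1, the n-th power of 2^-k is at most 2^-k, and a geometric series of sum 2
     remains. *)
  rewrite exprMn -/Q ler_wpM2l// -[leRHS]expr1.
  by apply: ler_wiXn2l => //; rewrite exprn_ile1// invf_le1// ler1n.
rewrite sumEFin lee_fin -mulr_sumr ler_wpM2l//.
have -> : \sum_(0 <= k < p) (2^-1 : R) ^+ k = 2 - 2 * 2^-1 ^+ p.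
  elim: p => [|p IH]; first by rewrite big_nil expr0 mulr1 subrr.
  by rewrite big_nat_recr//= IH exprS; field.
by rewrite gerBl mulr_ge0// exprn_ge0.
Qed.

End volume.

(** * The dichotomy and the theorem *)

Section dichotomy.
Context {R : realType} {n : nat} {K u : 'rV[R]_n -> R} {N R0 a b Cs : R}.
Context (sol : exterior_solution K u N R0 a b) (Cs_gt0 : 0 < Cs).
Context (slow : forall x, R0 <= enorm x -> u x <= Cs * enorm x `^ (- (N / 2))).

Local Notation W := (conformal_factor u).

Let n2 : n%:R - 2 = N. Proof. by rewrite (sol_dim sol) addrK. Qed.

Lemma decay_or_fat_annuli :
  (exists C r, [/\ 0 < C, 0 < r &
    forall x, r <= enorm x -> u x <= C * enorm x `^ (- N)]) \/
  (exists2 m, 0 < m & forall rho, exists2 r, rho <= r & 0 < r /\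
    forall x, r <= enorm x -> enorm x <= 2 * r -> m / r <= W x).
Proof.
have [Ngt0 Nn0] := (sol_N_gt0 sol, sol_N_neq0 sol).
have [b0 R00] := (sol_b_gt0 sol, sol_R0_gt0 sol).
(* Half of the threshold 3 N^2 / 16, divided by b, so that [e0] satisfies the smallness condition
   strictly. *)
pose q := 3 / 32 * N ^+ 2 / b.
have N20 : 0 < N ^+ 2 by rewrite exprn_gt0.
have q0 : 0 < q by rewrite divr_gt0// mulr_gt0.
pose e0 := q `^ ((4 / N)^-1).
have e00 : 0 < e0 by rewrite powR_gt0.
have be0 : b * e0 `^ (4 / N) < 3 / 16 * N ^+ 2.
  rewrite /e0 powRKl//; last by rewrite mulf_neq0// invr_eq0.
  by rewrite /q mulrC divfK ?gt_eqF//; lra.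
have [[R1 R01 HR1]|H] := pselect (exists2 R1, R0 <= R1 &
    forall x, R1 <= enorm x -> u x <= e0 * enorm x `^ (- (N / 2))).
  have [C [r [C0 rR HC]]] := fast_decay_of_small sol e00 be0 R01 HR1.
  by left; exists C, r; split => //; exact: lt_le_trans rR.
right; have [c1 c10 Hc1] := annulus_lower_bound sol Cs_gt0 slow e00.
have N2 : 0 < 2 / N by rewrite divr_gt0.
exists (c1 `^ (2 / N)); first exact: powR_gt0.
move=> rho; pose R1 := Num.max (4 * R0) rho.
have [y [yR1 uy]] : exists y, R1 <= enorm y /\ e0 * enorm y `^ (- (N / 2)) < u y.
  apply: contrapT => Hy; apply: H; exists R1.
    by rewrite le_max; apply/orP; left; lra.
  move=> y yR1; rewrite leNgt; apply/negP => uy.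
  by apply: Hy; exists y.
have yR : 4 * R0 <= enorm y by rewrite (le_trans _ yR1)// le_max lexx.
have y0 : 0 < enorm y by rewrite (lt_le_trans _ yR)// mulr_gt0.
exists (enorm y); first by rewrite (le_trans _ yR1)// le_max lexx orbT.
split => // x yx xy; have ux := Hc1 y yR (ltW uy) x yx xy.
have -> : c1 `^ (2 / N) / enorm y = (c1 * enorm y `^ (- (N / 2))) `^ (2 / N).
  rewrite powRM ?powR_ge0 ?(ltW c10)// -powRrM -(powR_inv1 (enorm_ge0 y)).
  by congr (_ * _ `^ _); field.
rewrite /conformal_factor n2; apply: ge0_ler_powR => //; first exact: ltW.
- by rewrite nnegrE mulr_ge0 ?powR_ge0// ltW.
- by rewrite nnegrE ltW// (sol_gt0 sol).
Qed.

Lemma conformal_factor_decay (C r : R) : 0 < C -> 0 < r ->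
  (forall x, r <= enorm x -> u x <= C * enorm x `^ (- N)) ->
  forall x, r <= enorm x -> W x <= C `^ (2 / N) / enorm x ^+ 2.
Proof.
move=> C0 r0 HC x rx; have x0 := lt_le_trans r0 rx.
have -> : C `^ (2 / N) / enorm x ^+ 2 = (C * enorm x `^ (- N)) `^ (2 / N).
  rewrite powRM ?powR_ge0 ?(ltW C0)// -powRrM -(powR_invn 2 (enorm_ge0 x)).
  by congr (_ * _ `^ _); field; rewrite (sol_N_neq0 sol).
rewrite /conformal_factor n2; apply: ge0_ler_powR; last exact: HC.
- by rewrite divr_ge0// ltW// (sol_N_gt0 sol).
- by rewrite nnegrE ltW// (sol_gt0 sol).
- by rewrite nnegrE mulr_ge0 ?powR_ge0// ltW.
Qed.

End dichotomy.

Theorem theoremC (R : realType) (n : nat) (n_ge3 : (3 <= n)%N)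
    (K u : 'rV[R]_n -> R)
    (K_smooth : smooth K)
    (K_bounds : exists (C : set 'rV[R]_n) (a b : R),
        [/\ compact C, 0 < a, 0 < b &
            forall x, ~ C x -> a <= K x <= b])
    (u_gt0 : forall x, 0 < u x)
    (u_smooth : smooth u)
    (u_eq : forall x,
        laplacian u x + K x * u x `^ ((n%:R + 2) / (n%:R - 2)) = 0)
    (u_slow : slow_decay u) :
  (fast_decay u \/ complete_metric (conformal_metric u)) /\
  (complete_metric (conformal_metric u) <-> total_volume u = +oo%E).
Proof.
have [C [a [b [cC a0 b0 Kab]]]] := K_bounds.
have [Cs [rs [Cs0 rs0 us]]] := u_slow.
have [T T0 CT] := compact_enorm_bounded cC.
have n3 : (3 : R) <= n%:R by rewrite ler_nat.
have N0 : 0 < n%:R - 2 :> R by lra.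
have Nn0 : n%:R - 2 != 0 :> R by rewrite gt_eqF.
have n_gt0 : (0 < n)%N by exact: leq_trans n_ge3.
(* The summand 1 places every x with |x| >= R0 strictly outside a ball that contains C. *)
pose R0 := Num.max (T + 1) rs.
have sol : exterior_solution K u (n%:R - 2) R0 a b.
  split => //.
  - by rewrite subrK.
  - lra.
  - move=> x; have -> : n%:R - 2 + 4 = n%:R + 2 :> R by ring.
    exact: u_eq.
  - by rewrite lt_max rs0 orbT.
  - move=> x xR; apply: Kab => /CT; apply/negP; rewrite -ltNge.
    by rewrite (lt_le_trans _ xR)// lt_max ltrDl ltr01.
have slow x : R0 <= enorm x -> u x <= Cs * enorm x `^ (- ((n%:R - 2) / 2)).
  by move=> xR; apply: us; rewrite (le_trans _ xR)// le_max lexx orbT.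
have ucont := continuous_sol sol.
have [[Cf [rf [Cf0 rf0 uf]]]|[m m0 Hm]] := decay_or_fat_annuli sol Cs0 slow.
  have HW := conformal_factor_decay sol Cf0 rf0 uf.
  have W0 : 0 < Cf `^ (2 / (n%:R - 2)) by rewrite powR_gt0.
  split; first by left; exists Cf, rf.
  (* Under fast decay both sides of the equivalence are false; in the other case both hold. *)
  split => [cg|V].
    by have := incomplete_of_decay ucont u_gt0 n_gt0 W0 rf0 HW.
  have := volume_finite_of_decay ucont u_gt0 n_gt0 Nn0 W0 rf0 HW.
  by rewrite V ltxx.
have cg := complete_of_fat_annuli ucont u_gt0 m0 Hm.
split; first by right.
by split => // _; exact: volume_infinite_of_fat_annuli u_gt0 m n_gt0 Nn0 m0 Hm.
Qed.
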